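(* Let $\mathcal{A}(\cdot,\cdot)$ be the symmetric interior penalty bilinear form for linear elasticity on $\boldsymbol{V}^{DG}$ and let $\mathcal{B}$ be the bilinear form $$\mathcal{B}((\boldsymbol z,\boldsymbol v),(\boldsymbol\zeta,\boldsymbol\phi))=\mathcal{A}(\boldsymbol z,\boldsymbol\zeta)+\mathcal{A}(\boldsymbol v,\boldsymbol\phi),\qquad \boldsymbol z,\boldsymbol\zeta\in\boldsymbol{\mathcal Z},\ \boldsymbol v,\boldsymbol\phi\in\boldsymbol V^{CR}$$ (both as in the context). There is a constant $\gamma$ with $0\le\gamma<1$, depending only on $\alpha_0$, $\alpha_1$ and the constant $\rho$ described in the context (hence independent of the mesh size $h$ and of the Lamé parameters $\lambda,\mu$), namely a constant for which $\mathcal A(\boldsymbol z,\boldsymbol v)^2\le\gamma^2\mathcal A(\boldsymbol z,\boldsymbol z)\,\mathcal A(\boldsymbol v,\boldsymbol v)$ for all $\boldsymbol z\in\boldsymbol{\mathcal Z}$, $\boldsymbol v\in\boldsymbol V^{CR}$, such that for all $\boldsymbol z\in\boldsymbol{\mathcal Z}$ and all $\boldsymbol v\in\boldsymbol V^{CR}$ $$\frac{1}{1+\gamma}\,\mathcal{A}(\boldsymbol z+\boldsymbol v,\boldsymbol z+\boldsymbol v)\ \le\ \mathcal{B}((\boldsymbol z,\boldsymbol v),(\boldsymbol z,\boldsymbol v))\ \le\ \frac{1}{1-\gamma}\,\mathcal{A}(\boldsymbol z+\boldsymbol v,\boldsymbol z+\boldsymbol v).$$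
   Context: Mesh. $\Omega\subset\mathbb R^d$, $d\in\{2,3\}$, is a polygon/polyhedron, $\partial\Omega=\Gamma_D\cup\Gamma_N$ (either part may be empty). $\mathcal T_h$ is a conforming (no hanging nodes) shape-regular partition of $\Omega$ into simplices $T$ of diameter $h_T$, $h=\max_T h_T$; the shape-regularity constant is a bound on $\max_T h_T/r_T$, $r_T$ the inradius. $\mathcal E_h^o$ is the set of interior faces ($(d-1)$-dimensional simplices); each boundary face belongs either to the set $\mathcal E_h^D$ of faces on $\Gamma_D$ or to the set $\mathcal E_h^N$ of faces on $\Gamma_N$. $h_E$ is the diameter of the face $E$, $m_E$ its barycenter. Each face $E$ carries a fixed unit normal $\boldsymbol n$ (outward to $\Omega$ on boundary faces); for interior $E$, $T^+$ (resp. $T^-$) is the neighbor for which $\boldsymbol n$ is outward (resp. inward). Traces. On interior faces $\{\!\{w\}\!\}=(w^++w^-)/2$ and $[\![w]\!]=w^+-w^-$, where $w^\pm$ are the traces from $T^\pm$; on boundary faces $\{\!\{w\}\!\}=[\![w]\!]=w$. $\mathcal P_E^0 w=\frac1{|E|}\int_E w$ is the $L^2(E)$-projection onto constants (componentwise for vectors). Spaces. $\boldsymbol V^{DG}$ is the space of vector fields in $[L^2(\Omega)]^d$ whose restriction to each $T\in\mathcal T_h$ lies in $[\mathbb P^1(T)]^d$ (affine). Put $$\boldsymbol V^{CR}=\{\boldsymbol v\in\boldsymbol V^{DG}:\mathcal P^0_E[\![\boldsymbol v]\!]=0\ \ \forall E\in\mathcal E_h^o\cup\mathcal E_h^D\},\qquad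 \boldsymbol{\mathcal Z}=\{\boldsymbol z\in\boldsymbol V^{DG}:\mathcal P^0_E\{\!\{\boldsymbol z\}\!\}=0\ \ \forall E\in\mathcal E_h^o\cup\mathcal E_h^N\}.$$ One has $\boldsymbol V^{DG}=\boldsymbol V^{CR}\oplus\boldsymbol{\mathcal Z}$. Bilinear forms. $0<\mu_1<\mu<\mu_2$ and $0\le\lambda<\infty$ are the (constant) Lamé parameters, $\mathcal C A=2\mu A+\lambda\,\mathrm{trace}(A)I$ for symmetric $A$, $\boldsymbol\varepsilon(\boldsymbol u)=\frac12(\nabla\boldsymbol u+(\nabla\boldsymbol u)^T)$ (elementwise), $\beta_0=d\lambda+2\mu$, $\beta_1=2\mu$. With $\langle\cdot:\cdot\rangle$ the Frobenius product, $$\mathcal A_0(\boldsymbol u,\boldsymbol w)=\sum_{T}\int_T\langle\mathcal C\boldsymbol\varepsilon(\boldsymbol u):\boldsymbol\varepsilon(\boldsymbol w)\rangle-\sum_{E\in\mathcal E_h^o\cup\mathcal E_h^D}\int_E\Big(\langle\{\!\{(\mathcal C\boldsymbol\varepsilon(\boldsymbol u))\boldsymbol n\}\!\},[\![\boldsymbol w]\!]\rangle+\langle[\![\boldsymbol u]\!],\{\!\{(\mathcal C\boldsymbol\varepsilon(\boldsymbol w))\boldsymbol n\}\!\}\rangle\Big)+\alpha_0\beta_0\sum_{E\in\mathcal E_h^o\cup\mathcal E_h^D}h_E^{-1}\int_E\langle[\![\boldsymbol u]\!],\mathcal P_E^0[\![\boldsymbol w]\!]\rangle,$$ $$\mathcal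 A(\boldsymbol u,\boldsymbol w)=\mathcal A_0(\boldsymbol u,\boldsymbol w)+\alpha_1\beta_1\sum_{E\in\mathcal E_h^o\cup\mathcal E_h^D}h_E^{-1}\int_E\langle[\![\boldsymbol u]\!],[\![\boldsymbol w]\!]\rangle.$$ Standing assumption on penalties: $\alpha_1>0$, and $\alpha_0\ge1$ is chosen large enough (depending only on $d$ and shape regularity) that for all $\boldsymbol v\in\boldsymbol V^{DG}$ $$\mathcal A_0(\boldsymbol v,\boldsymbol v)\ge\tfrac12\sum_T\int_T\langle\mathcal C\boldsymbol\varepsilon(\boldsymbol v):\boldsymbol\varepsilon(\boldsymbol v)\rangle+\tfrac{\alpha_0}{2}\beta_0\sum_{E\in\mathcal E_h^o\cup\mathcal E_h^D}h_E^{-1}\|\mathcal P^0_E[\![\boldsymbol v]\!]\|_{0,E}^2 .$$ The constant $\rho$: $\rho\ge1$ is a constant depending only on $d$ and the shape regularity of the mesh such that for all $\boldsymbol z\in\boldsymbol{\mathcal Z}$ $$\sum_{E\in\mathcal E_h^o\cup\mathcal E_h^D}h_E^{-1}\|[\![\boldsymbol z]\!]-\mathcal P^0_E[\![\boldsymbol z]\!]\|_{0,E}^2\le\Big(1-\frac1\rho\Big)\sum_{E\in\mathcal E_h^o\cup\mathcal E_h^D}h_E^{-1}\|[\![\boldsymbol z]\!]\|_{0,E}^2 .$$ *)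

(* Defs.v *)
From HB Require Import structures.
From mathcomp Require Import all_boot all_order all_algebra.
From mathcomp Require Import all_classical all_reals all_analysis.
Set Implicit Arguments.
Unset Strict Implicit.
Unset Printing Implicit Defensive.
Import Order.TTheory GRing.Theory Num.Theory.
Import numFieldNormedType.Exports.
Local Open Scope classical_set_scope.
Local Open Scope ring_scope.

(* The library norm on matrices is the max norm, hence the Euclidean one here. *)
Definition dotv (R : realType) (n : nat) (u w : 'rV[R]_n) : R :=
  \sum_j u 0 j * w 0 j.

Definition enorm (R : realType) (n : nat) (u : 'rV[R]_n) : R :=
  Num.sqrt (dotv u u).

Definition frob (R : realType) (n : nat) (A B : 'M[R]_n) : R :=
  \sum_i \sum_j A i j * B i j.

Definition diam (R : realType) (n : nat) (A : set 'rV[R]_n) : R :=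
  sup [set r | exists x y, [/\ A x, A y & r = enorm (x - y)]].

Definition inradius (R : realType) (n : nat) (A : set 'rV[R]_n) : R :=
  sup [set r | 0 <= r /\
         exists c, [set x : 'rV[R]_n | enorm (x - c) <= r] `<=` A].

(* Iterated Lebesgue integral over {t in R^k | t_i >= 0, t_1 + ... + t_k <= c}. *)
Fixpoint corner_int (R : realType) (k : nat) (c : R) :
    ('rV[R]_k -> R) -> R :=
  match k return ('rV[R]_k -> R) -> R with
  | 0 => fun f => f 0
  | k'.+1 => fun f =>
      \int[lebesgue_measure]_(t in `[0, c])
        corner_int (c - t)
          (fun y : 'rV[R]_k' => f (row_mx (const_mx t : 'rV[R]_1) y))
  end.

Definition edge_mx (R : realType) (d k : nat) (p : seq 'rV[R]_d) :
    'M[R]_(k, d) :=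
  \matrix_(i < k) (p`_i.+1 - p`_0).

(* Integral, for the k-dimensional surface measure, over the simplex with
   vertices p_0, ..., p_k in R^d, pulled back along t |-> p_0 + t *m edge_mx;
   the Jacobian factor is the square root of the Gram determinant (|det| when
   k = d). *)
Definition simplex_int (R : realType) (d k : nat) (p : seq 'rV[R]_d)
    (f : 'rV[R]_d -> R) : R :=
  Num.sqrt (\det (edge_mx k p *m (edge_mx k p)^T)) *
  corner_int 1 (fun t : 'rV[R]_k => f (p`_0 + t *m edge_mx k p)).

(* Simplices are sets of vertex labels; cells are labelled by 'I_ncells. The
   values of face_normal outside the faces are irrelevant. *)
Record mesh (R : realType) (d : nat) := Mesh {
  Omega : set 'rV[R]_d;
  GammaD : set 'rV[R]_d;
  GammaN : set 'rV[R]_d;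
  nvertices : nat;
  ncells : nat;
  vtx : 'I_nvertices -> 'rV[R]_d;
  cell : 'I_ncells -> {set 'I_nvertices};
  face_normal : {set 'I_nvertices} -> 'rV[R]_d
}.

Section MeshDefs.
Variables (R : realType) (d : nat) (M : mesh R d).
Implicit Types (S E : {set 'I_(nvertices M)}) (T : 'I_(ncells M)).

Definition points S : seq 'rV[R]_d := [seq vtx i | i <- enum S].

Definition hull S : set 'rV[R]_d :=
  [set x | exists w : 'I_(nvertices M) -> R,
     [/\ forall i, 0 <= w i, forall i, i \notin S -> w i = 0,
         \sum_i w i = 1 & x = \sum_i w i *: vtx i]].

Definition neighbors E : {set 'I_(ncells M)} :=
  [set T : 'I_(ncells M) | E \subset cell T]%SET.

Definition faces : {set {set 'I_(nvertices M)}} :=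
  [set E : {set 'I_(nvertices M)} |
     (#|E| == d) && (0 < #|neighbors E|)%N]%SET.

Definition interior_faces : {set {set 'I_(nvertices M)}} :=
  [set E in faces | #|neighbors E| == 2]%SET.

Definition boundary_faces : {set {set 'I_(nvertices M)}} :=
  [set E in faces | #|neighbors E| == 1]%SET.

Definition dirichlet_faces : {set {set 'I_(nvertices M)}} :=
  [set E in boundary_faces | `[< hull E `<=` GammaD M >]]%SET.

Definition neumann_faces : {set {set 'I_(nvertices M)}} :=
  [set E in boundary_faces | `[< hull E `<=` GammaN M >]]%SET.

Definition outward E T : bool :=
  [forall a in cell T :\: E, forall b in E,
     dotv (vtx a - vtx b) (face_normal E) < 0].

Definition inward E T : bool :=
  [forall a in cell T :\: E, forall b in E,
     0 < dotv (vtx a - vtx b) (face_normal E)].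

(* On a conforming mesh, Tplus and Tminus are defined and unique on interior
   faces, and Tplus is the only neighbor of a boundary face. *)
Definition Tplus E : option 'I_(ncells M) :=
  [pick T | (T \in neighbors E) && outward E T].

Definition Tminus E : option 'I_(ncells M) :=
  [pick T | (T \in neighbors E) && inward E T].

Definition cell_int T (f : 'rV[R]_d -> R) : R :=
  simplex_int d (points (cell T)) f.

Definition face_int E (f : 'rV[R]_d -> R) : R :=
  simplex_int d.-1 (points E) f.

Definition h_cell T : R := diam (hull (cell T)).
Definition h_face E : R := diam (hull E).

(* Omega is regular open, which excludes slits: the faces with a single neighbor
   are then exactly those contained in the boundary of Omega. *)
Record conforming_mesh : Prop := ConformingMesh {
  polyhedral_open : open (Omega M);
  polyhedral_regular : interior (closure (Omega M)) = Omega M;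
  polyhedral_nonempty : Omega M !=set0;
  boundary_split : closure (Omega M) `\` Omega M = GammaD M `|` GammaN M;
  vtx_inj : injective (@vtx _ _ M);
  cell_inj : injective (@cell _ _ M);
  card_cell : forall T, #|cell T| = d.+1;
  cell_nondegenerate : forall T, row_free (edge_mx d (points (cell T)));
  cells_cover : closure (Omega M) = \bigcup_T hull (cell T);
  no_hanging_nodes : forall T T', T != T' ->
    hull (cell T) `&` hull (cell T') = hull (cell T :&: cell T');
  boundary_faces_cover : dirichlet_faces :|: neumann_faces = boundary_faces;
  boundary_faces_disjoint : dirichlet_faces :&: neumann_faces = finset.set0;
  normal_unit : forall E, E \in faces -> enorm (face_normal E) = 1;
  normal_orthogonal : forall E a b, E \in faces -> a \in E -> b \in E ->
    dotv (vtx a - vtx b) (face_normal E) = 0;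
  normal_outward : forall E T, E \in boundary_faces -> T \in neighbors E ->
    outward E T
}.

Definition shape_regular (sigma : R) : Prop :=
  forall T, h_cell T / inradius (hull (cell T)) <= sigma.

(* Piecewise smooth vector fields, one function per cell, so that both one-sided
   traces on a face are available. An L^2 field whose restriction to each cell
   is affine is identified with the family of these affine functions. *)
Definition broken_field := 'I_(ncells M) -> 'rV[R]_d -> 'rV[R]_d.
Implicit Types (u v w : broken_field).

Definition trace_from (o : option 'I_(ncells M)) w (x : 'rV[R]_d) : 'rV[R]_d :=
  if o is Some T then w T x else 0.

Definition avg E w (x : 'rV[R]_d) : 'rV[R]_d :=
  if E \in interior_faces
  then 2^-1 *: (trace_from (Tplus E) w x + trace_from (Tminus E) w x)
  else trace_from (Tplus E) w x.

Definition jump E w (x : 'rV[R]_d) : 'rV[R]_d :=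
  if E \in interior_faces
  then trace_from (Tplus E) w x - trace_from (Tminus E) w x
  else trace_from (Tplus E) w x.

Definition P0 E (g : 'rV[R]_d -> 'rV[R]_d) : 'rV[R]_d :=
  \row_j ((face_int E (fun=> 1))^-1 * face_int E (fun x => g x 0 j)).

Definition L2sq E (g : 'rV[R]_d -> 'rV[R]_d) : R :=
  face_int E (fun x => dotv (g x) (g x)).

Definition affine (g : 'rV[R]_d -> 'rV[R]_d) : Prop :=
  exists (A : 'M[R]_d) (b : 'rV[R]_d), forall x, g x = x *m A + b.

Definition VDG : set broken_field := [set v | forall T, affine (v T)].

Definition VCR : set broken_field :=
  [set v | VDG v /\ forall E, E \in interior_faces :|: dirichlet_faces ->
     P0 E (jump E v) = 0].

Definition Zspace : set broken_field :=
  [set z | VDG z /\ forall E, E \in interior_faces :|: neumann_faces ->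
     P0 E (avg E z) = 0].

(* 'J g x is the transpose of the matrix of the (d_j g_i). *)
Definition eps (g : 'rV[R]_d -> 'rV[R]_d) (x : 'rV[R]_d) : 'M[R]_d :=
  2^-1 *: (('J g x)^T + 'J g x).

Section Forms.
Variables (lam mu : R).

Definition stiffness (A : 'M[R]_d) : 'M[R]_d :=
  (2 * mu) *: A + (lam * \tr A) *: 1%:M.

Definition beta0 : R := d%:R * lam + 2 * mu.
Definition beta1 : R := 2 * mu.

Definition traction E u : broken_field :=
  fun T x => (stiffness (eps (u T) x) *m (face_normal E)^T)^T.

Definition energy u w : R :=
  \sum_T cell_int T (fun x => frob (stiffness (eps (u T) x)) (eps (w T) x)).

Definition aformIP0 (alpha0 : R) u w : R :=
  energy u w
  - \sum_(E in interior_faces :|: dirichlet_faces)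
      face_int E (fun x => dotv (avg E (traction E u) x) (jump E w x)
                         + dotv (jump E u x) (avg E (traction E w) x))
  + alpha0 * beta0 * \sum_(E in interior_faces :|: dirichlet_faces)
      (h_face E)^-1 * face_int E (fun x => dotv (jump E u x) (P0 E (jump E w))).

Definition aformIP (alpha0 alpha1 : R) u w : R :=
  aformIP0 alpha0 u w
  + alpha1 * beta1 * \sum_(E in interior_faces :|: dirichlet_faces)
      (h_face E)^-1 * face_int E (fun x => dotv (jump E u x) (jump E w x)).

Definition bformIP (alpha0 alpha1 : R) (p q : broken_field * broken_field) : R :=
  aformIP alpha0 alpha1 p.1 q.1 + aformIP alpha0 alpha1 p.2 q.2.

Definition penalty_coercive (alpha0 : R) : Prop :=
  forall v, VDG v ->
    2^-1 * energy v v
    + alpha0 / 2 * beta0 * \sum_(E in interior_faces :|: dirichlet_faces)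
        (h_face E)^-1 * L2sq E (fun=> P0 E (jump E v))
    <= aformIP0 alpha0 v v.

End Forms.

Definition jump_contraction (rho : R) : Prop :=
  forall z, Zspace z ->
    \sum_(E in interior_faces :|: dirichlet_faces)
      (h_face E)^-1 * L2sq E (fun x => jump E z x - P0 E (jump E z))
    <= (1 - rho^-1) * \sum_(E in interior_faces :|: dirichlet_faces)
         (h_face E)^-1 * L2sq E (jump E z).

End MeshDefs.

(* Main.v *)
Require Import Defs.
From HB Require Import structures.
From mathcomp Require Import all_boot all_order all_algebra.
From mathcomp Require Import all_classical all_reals all_analysis.
From mathcomp Require Import perm ring lra.
Import Order.TTheory GRing.Theory Num.Theory.
Import numFieldNormedType.Exports.
Local Open Scope classical_set_scope.
Local Open Scope ring_scope.
Set Implicit Arguments.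
Unset Strict Implicit.
Unset Printing Implicit Defensive.

(** Integrating by parts cell by cell turns [energy z v] into face integrals of
    the constant traction of [v] against the trace of [z]. The average of [z] has
    zero mean on interior and Neumann faces, so only the consistency term of
    [aformIP0] survives, and the remaining face terms vanish because the jumps of
    [v] have zero mean: [aformIP0 z v = 0]. Hence [aformIP z v] is
    [alpha1 * beta1] times the sum of the
    [h_E^-1 int_E (jump z - P0 (jump z)) . jump v], and Cauchy-Schwarz,
    [jump_contraction] and
    [alpha1 * beta1 * sum_E h_E^-1 |jump w|^2 <= aformIP w w] give the
    strengthened Cauchy-Schwarz inequality with [gamma^2 = 1 - 1 / rho].

    For affine fields on a simplex [T] the divergence theorem is algebra: the
    outward normal scaled by the face area is [- d |T|] times the gradient of the
    barycentric coordinate of the opposite vertex. *)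

(** Cell and face integrals are iterated Lebesgue integrals, whose additivity calls for
    integrability of every inner integral. The integrands that occur are polynomial, and for these
    each inner integral is again a polynomial in the outer variable; one-variable calculus thus
    carries linearity through all dimensions without a Fubini argument. It also yields the exact
    integration of affine functions from vertex values on which the algebraic divergence theorem
    rests.

    That a face has at most two neighbors, one on each side, is not a field of [conforming_mesh]; it
    is derived from the geometry, chiefly from [no_hanging_nodes].

    The constant is free of the Lamé parameters and the mesh size because [aformIP0], the part
    containing [lam], vanishes in the cross term and is nonnegative on the diagonal. The squared
    cross term carries [(alpha1 * beta1)^2], one factor for each diagonal term, so these weights
    cancel. The mean of [jump z] may be removed before Cauchy-Schwarz precisely because [jump v] has
    zero mean, and this is what makes the factor [1 - 1 / rho] available. *)

(** * Integrals of one-variable polynomials and the Beta integral *)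

Section PolynomialIntegral.
Variable R : realType.
Implicit Types (c t : R) (p q : {poly R}).

Definition poly_int c p : R := \int[lebesgue_measure]_(t in `[0, c]) p.[t].

Lemma integrable_horner c p :
  lebesgue_measure.-integrable `[0, c] (EFin \o horner p).
Proof.
apply: continuous_compact_integrable; first exact: segment_compact.
by apply: continuous_subspaceT => x; exact: continuous_horner.
Qed.

Lemma poly_intD c p q : poly_int c (p + q) = poly_int c p + poly_int c q.
Proof.
rewrite /poly_int -RintegralD//; [|exact: integrable_horner..].
by apply: eq_Rintegral => t _; rewrite hornerD.
Qed.

Lemma poly_intZ c a p : poly_int c (a *: p) = a * poly_int c p.
Proof.
rewrite /poly_int -RintegralZl//; last exact: integrable_horner.
by apply: eq_Rintegral => t _; rewrite hornerZ.
Qed.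

Lemma poly_int_deriv c p : 0 <= c -> poly_int c p^`() = p.[c] - p.[0].
Proof.
rewrite le_eqVlt => /predU1P[<-|c0].
  by rewrite subrr /poly_int set_itv1 Rintegral_set1.
rewrite /poly_int /Rintegral (@continuous_FTC2 _ _ (horner p))//.
- by apply: continuous_subspaceT => x; exact: continuous_horner.
- split=> [x _||]; first exact: derivable_horner.
  + by apply: cvg_at_right_filter; exact: continuous_horner.
  + by apply: cvg_at_left_filter; exact: continuous_horner.
- by move=> x _; rewrite derivE.
Qed.

(* Integration by parts moves one factor of ['X] at a time onto the other
   factor. *)
Lemma poly_int_beta c e j : 0 <= c ->
  poly_int c ('X^e * (c%:P - 'X) ^+ j)
  = (e`! * j`!)%:R / ((e + j).+1)`!%:R * c ^+ (e + j).+1.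
Proof.
move=> c0; elim: e j => [|e IHe] j.
  have -> : 'X^0 * (c%:P - 'X) ^+ j
      = (- j.+1%:R^-1) *: ((c%:P - 'X) ^+ j.+1)^`().
    rewrite deriv_exp derivB derivC derivX sub0r expr0 mul1r.
    rewrite mulN1r mulNrn scalerN scaleNr opprK -(scaler_nat j.+1 (_ ^+ _)) scalerA.
    by rewrite mulVf ?scale1r// pnatr_eq0.
  rewrite poly_intZ poly_int_deriv// !hornerE subrr expr0n/= sub0r ?add0n ?fact0.
  rewrite subr0 mulrNN factS natrM invfM mulrCA divff ?mulr1//.
have H : e.+1%:R * poly_int c ('X^e * (c%:P - 'X) ^+ j.+1)
    = j.+1%:R * poly_int c ('X^(e.+1) * (c%:P - 'X) ^+ j).
  have := @poly_int_deriv c ('X^(e.+1) * (c%:P - 'X) ^+ j.+1) c0.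
  rewrite !hornerE subrr !expr0n/= mulr0 mul0r subr0.
  rewrite derivM derivXn deriv_exp derivB derivC derivX sub0r/=.
  rewrite mulN1r mulNrn mulrN mulrnAr mulrnAl.
  rewrite -(scaler_nat e.+1) -(scaler_nat j.+1) -scaleNr poly_intD !poly_intZ.
  by move=> /eqP; rewrite addr_eq0 mulNr opprK => /eqP.
have j0 : j.+1%:R != 0 :> R by rewrite pnatr_eq0.
apply: (mulfI j0); rewrite -H IHe addnS addSn !factS !natrM.
by move: (c ^+ _) => x; rewrite !mulrA; congr (_ / _ * _); ring.
Qed.

End PolynomialIntegral.

(** * Polynomial functions and their integrals over the corner simplex *)

Section CornerIntegral.
Variable R : realType.

(** Coordinates are peeled off from the front exactly as in [corner_int], so that a slice of a
    monomial is a scaled monomial in the remaining variables. *)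
Fixpoint monomial_fun k : ('rV[R]_k -> R) -> Prop :=
  match k return ('rV[R]_k -> R) -> Prop with
  | 0 => fun f => forall x, f x = 1
  | k'.+1 => fun f => exists e (g : 'rV[R]_k' -> R), monomial_fun g /\
      forall t y, f (row_mx (const_mx t : 'rV[R]_1) y) = t ^+ e * g y
  end.

(** A list of scaled monomials, kept as a predicate on functions so that it applies directly to
    integrands; the induction principle adds one monomial at a time. *)
Inductive poly_fun k : ('rV[R]_k -> R) -> Prop :=
| poly_fun0 : poly_fun (fun=> 0)
| poly_fun_cons a m f : monomial_fun m -> poly_fun f ->
    poly_fun (fun x => a * m x + f x).

Lemma eq_corner_int k c (f g : 'rV[R]_k -> R) :
  f =1 g -> corner_int c f = corner_int c g.
Proof. by move=> /funext ->. Qed.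

Lemma corner_intS k c (f : 'rV[R]_k.+1 -> R) :
  corner_int c f = \int[lebesgue_measure]_(t in `[0, c])
    corner_int (c - t)
      (fun y : 'rV[R]_k => f (row_mx (const_mx t : 'rV[R]_1) y)).
Proof. by []. Qed.

Lemma corner_int_ge0 k c (f : 'rV[R]_k -> R) :
  (forall x, 0 <= f x) -> 0 <= corner_int c f.
Proof.
elim: k c f => [|k IHk] c f f0 /=; first exact: f0.
by apply: Rintegral_ge0 => t _; apply: IHk.
Qed.

Lemma poly_fun_scaled_monomial k a (m : 'rV[R]_k -> R) :
  monomial_fun m -> poly_fun (fun x => a * m x).
Proof.
move=> mm; rewrite (_ : (fun _ => _) = fun x => a * m x + 0).
  exact: poly_fun_cons mm (poly_fun0 _).
by apply/funext => x; rewrite addr0.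
Qed.

Lemma poly_funD k (f g : 'rV[R]_k -> R) :
  poly_fun f -> poly_fun g -> poly_fun (fun x => f x + g x).
Proof.
elim=> [|a m {}f mm _ IHf] pg.
  by rewrite (_ : (fun _ => _) = g)//; apply/funext => x; rewrite add0r.
rewrite (_ : (fun _ => _) = fun x => a * m x + (f x + g x)).
  exact: poly_fun_cons mm (IHf pg).
by apply/funext => x; rewrite addrA.
Qed.

Lemma poly_funZ k a (f : 'rV[R]_k -> R) :
  poly_fun f -> poly_fun (fun x => a * f x).
Proof.
elim=> [|b m {}f mm _ IHf].
  rewrite (_ : (fun _ => _) = fun=> 0); first exact: poly_fun0.
  by apply/funext => x; rewrite mulr0.
rewrite (_ : (fun _ => _) = fun x => a * b * m x + a * f x).
  exact: poly_fun_cons.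
by apply/funext => x; rewrite mulrDr mulrA.
Qed.

Lemma monomial_fun1 k : monomial_fun (fun _ : 'rV[R]_k => 1).
Proof.
elim: k => [//|k IHk]; exists 0%N, (fun=> 1); split=> // t y.
by rewrite expr0 mul1r.
Qed.

Lemma row_mx_const0 k (t : R) (y : 'rV[R]_k) :
  (row_mx (const_mx t : 'rV[R]_1) y : 'rV[R]_k.+1) 0 0 = t.
Proof.
have -> : 0 = lshift k 0 :> 'I_(1 + k) by apply/val_inj.
by rewrite (@row_mxEl R 1 1 k) mxE.
Qed.

Lemma row_mx_const_lift k (t : R) (y : 'rV[R]_k) j :
  (row_mx (const_mx t : 'rV[R]_1) y : 'rV[R]_k.+1) 0 (lift 0 j) = y 0 j.
Proof.
have -> : lift 0 j = rshift 1 j :> 'I_(1 + k) by apply/val_inj.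
by rewrite (@row_mxEr R 1 1 k).
Qed.

Lemma monomial_fun_coord k (i : 'I_k) :
  monomial_fun (fun x : 'rV[R]_k => x 0 i).
Proof.
elim: k i => [[]//|k IHk] i /=; case: (unliftP 0 i) => [j|] ->.
  exists 0%N, (fun x => x 0 j); split=> // t y.
  by rewrite row_mx_const_lift expr0 mul1r.
exists 1%N, (fun=> 1); split=> [|t y]; first exact: monomial_fun1.
by rewrite row_mx_const0 mulr1.
Qed.

Lemma monomial_funM k (m m' : 'rV[R]_k -> R) :
  monomial_fun m -> monomial_fun m' -> monomial_fun (fun x => m x * m' x).
Proof.
elim: k m m' => [|k IHk] m m' /=; first by move=> h h' x; rewrite h h' mulr1.
move=> [e [g [mg Eg]]] [e' [g' [mg' Eg']]].
exists (e + e')%N, (fun x => g x * g' x); split=> [|t y]; first exact: IHk.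
by rewrite Eg Eg' exprD mulrACA.
Qed.

Lemma poly_funM k (f g : 'rV[R]_k -> R) :
  poly_fun f -> poly_fun g -> poly_fun (fun x => f x * g x).
Proof.
move=> pf pg; elim: pf => [|a m {}f mm _ IHf].
  rewrite (_ : (fun _ => _) = fun=> 0); first exact: poly_fun0.
  by apply/funext => x; rewrite mul0r.
rewrite (_ : (fun _ => _) = fun x => a * (m x * g x) + f x * g x); last first.
  by apply/funext => x; rewrite mulrDl mulrA.
apply: poly_funD IHf; apply: poly_funZ.
elim: pg => [|b m' {}g mm' _ IHg].
  rewrite (_ : (fun _ => _) = fun=> 0); first exact: poly_fun0.
  by apply/funext => x; rewrite mulr0.
rewrite (_ : (fun _ => _) = fun x => b * (m x * m' x) + m x * g x).
  by apply: poly_fun_cons IHg; exact: monomial_funM.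
by apply/funext => x; rewrite mulrDr mulrCA.
Qed.

Lemma poly_fun_cst k a : poly_fun (fun _ : 'rV[R]_k => a).
Proof.
rewrite (_ : (fun _ => _) = fun x : 'rV[R]_k => a * 1).
  exact/poly_fun_scaled_monomial/monomial_fun1.
by apply/funext => x; rewrite mulr1.
Qed.

Lemma poly_fun_coord k i : poly_fun (fun x : 'rV[R]_k => x 0 i).
Proof.
rewrite (_ : (fun _ => _) = fun x : 'rV[R]_k => 1 * x 0 i).
  exact/poly_fun_scaled_monomial/monomial_fun_coord.
by apply/funext => x; rewrite mul1r.
Qed.

Lemma poly_fun_sum k (I : Type) (r : seq I) (F : I -> 'rV[R]_k -> R) :
  (forall i, poly_fun (F i)) -> poly_fun (fun x => \sum_(i <- r) F i x).
Proof.
move=> pF; elim: r => [|i r IHr].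
  rewrite (_ : (fun _ => _) = fun=> 0); first exact: poly_fun0.
  by apply/funext => x; rewrite big_nil.
rewrite (_ : (fun _ => _) = fun x => F i x + \sum_(i <- r) F i x).
  exact: poly_funD.
by apply/funext => x; rewrite big_cons.
Qed.

Lemma poly_fun_slice k (f : 'rV[R]_(1 + k) -> R) t :
  @poly_fun k.+1 f ->
  poly_fun (fun y : 'rV[R]_k => f (row_mx (const_mx t : 'rV[R]_1) y)).
Proof.
elim=> [|a m {}f [e [g [mg Eg]]] _ IHf]; first exact: poly_fun0.
rewrite (_ : (fun _ => _) = fun y => a * t ^+ e * g y
    + f (row_mx (const_mx t : 'rV[R]_1) y)); first exact: poly_fun_cons.
by apply/funext => y; rewrite Eg mulrA.
Qed.

(** By homogeneity the inner integral is a constant times a power of [c - t], so each layer is a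
    Beta integral. The scalar [a] is carried through the induction because linearity of [corner_int]
    is not yet available. *)
Lemma corner_int_scaled_monomial k (m : 'rV[R]_k -> R) : monomial_fun m ->
  exists C n, forall a c, 0 <= c ->
    corner_int c (fun x => a * m x) = a * C * c ^+ n.
Proof.
elim: k m => [|k IHk] m /=.
  by move=> m1; exists 1, 0%N; move=> a c _; rewrite m1 expr0 !mulr1.
move=> [e [g [mg Eg]]]; have [C [n H]] := IHk _ mg.
exists (C * ((e`! * n`!)%:R / ((e + n).+1)`!%:R)), (e + n).+1; move=> a c c0.
rewrite mulrA -(mulrA _ _ (c ^+ _)) -(poly_int_beta _ _ c0) -poly_intZ.
apply: eq_Rintegral => t; rewrite inE/= in_itv/= => /andP[t0 tc].
under eq_corner_int do rewrite Eg mulrA.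
rewrite H ?subr_ge0// hornerZ hornerM hornerXn horner_exp hornerD hornerN hornerC
  hornerX.
by move: (t ^+ e) (_ ^+ n) => x y; ring.
Qed.

(** Polynomial dependence on [t] is what makes the outer integrand integrable. Linearity in
    dimension [k] is a hypothesis because the lemma serves inside the induction that proves it. *)
Lemma corner_int_slice_horner k (f : 'rV[R]_(1 + k) -> R) c :
  (forall a (m g : 'rV[R]_k -> R) c', 0 <= c' ->
     monomial_fun m -> poly_fun g ->
     corner_int c' (fun x => a * m x + g x)
     = a * corner_int c' m + corner_int c' g) ->
  (forall c', corner_int c' (fun _ : 'rV[R]_k => 0) = 0) ->
  @poly_fun k.+1 f -> exists p : {poly R}, forall t, 0 <= t <= c ->
    corner_int (c - t) (fun y : 'rV[R]_k => f (row_mx (const_mx t : 'rV[R]_1) y))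
    = p.[t].
Proof.
move=> HD H0; elim=> [|a m {}f [e [g [mg Eg]]] pf [p Hp]].
  by exists 0 => t _; rewrite H0 horner0.
have [C [n H]] := corner_int_scaled_monomial mg.
exists ((a * C) *: ('X^e * (c%:P - 'X) ^+ n) + p) => t tc.
under eq_corner_int do rewrite Eg mulrA.
have ct : 0 <= c - t by case/andP: tc => _; rewrite subr_ge0.
rewrite HD//; last exact: (@poly_fun_slice k).
rewrite Hp// hornerD; congr (_ + _).
have := H 1 _ ct; under eq_corner_int do rewrite mul1r.
move=> ->; rewrite hornerZ hornerM hornerXn horner_exp hornerD hornerN hornerC
  hornerX.
by move: (t ^+ e) (_ ^+ n) => x y; ring.
Qed.

Lemma corner_int0 k c : corner_int c (fun _ : 'rV[R]_k => 0) = 0.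
Proof.
elim: k c => [//|k IHk] c /=.
under eq_Rintegral do rewrite IHk.
by rewrite Rintegral_cst// mul0r.
Qed.

(** Induction on the dimension: linearity in dimension [k] replaces the slices by one-variable
    polynomials on [[0, c]], and linearity of [poly_int] gives the next dimension. *)
Lemma corner_int_cons k a (m f : 'rV[R]_k -> R) c : 0 <= c ->
  monomial_fun m -> poly_fun f ->
  corner_int c (fun x => a * m x + f x) = a * corner_int c m + corner_int c f.
Proof.
elim: k a m f c => [//|k IHk] a m f c c0 mm pf.
have [e [g [mg Eg]]] := mm.
have pm : @poly_fun k.+1 (fun x => 1 * m x) by exact: poly_fun_scaled_monomial.
have [p Hp] := corner_int_slice_horner c IHk (@corner_int0 k) pf.
have [q Hq] := corner_int_slice_horner c IHk (@corner_int0 k) pm.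
rewrite !corner_intS; transitivity (poly_int c (a *: q + p)).
  apply: eq_Rintegral => t; rewrite inE/= in_itv/= => tc.
  have ct : 0 <= c - t by case/andP: tc => _; rewrite subr_ge0.
  under eq_corner_int do rewrite Eg mulrA.
  rewrite IHk//; last exact: (@poly_fun_slice k).
  rewrite Hp// hornerD hornerZ -Hq//; congr (_ + _).
  under [in RHS]eq_corner_int do rewrite mul1r Eg -[_ * _]addr0.
  by rewrite IHk ?corner_int0 ?addr0 ?mulrA//; exact: poly_fun0.
rewrite poly_intD poly_intZ; congr (_ * _ + _).
  apply: eq_Rintegral => t; rewrite inE/= in_itv/= => tc.
  by rewrite -Hq//; under [in LHS]eq_corner_int do rewrite mul1r.
by apply: eq_Rintegral => t; rewrite inE/= in_itv/= => tc; rewrite Hp.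
Qed.

Lemma corner_intD k c (f g : 'rV[R]_k -> R) : 0 <= c ->
  poly_fun f -> poly_fun g ->
  corner_int c (fun x => f x + g x) = corner_int c f + corner_int c g.
Proof.
move=> c0 pf pg; elim: pf => [|a m {}f mm pf IHf].
  by rewrite corner_int0 add0r; under [in LHS]eq_corner_int do rewrite add0r.
under [in LHS]eq_corner_int do rewrite -addrA.
rewrite !corner_int_cons ?IHf ?addrA//; exact: poly_funD.
Qed.

Lemma corner_intZ k c a (f : 'rV[R]_k -> R) : 0 <= c -> poly_fun f ->
  corner_int c (fun x => a * f x) = a * corner_int c f.
Proof.
move=> c0; elim=> [|b m {}f mm pf IHf].
  by rewrite corner_int0 mulr0 corner_int0.
under [in LHS]eq_corner_int do rewrite mulrDr mulrA.
by rewrite !corner_int_cons ?IHf ?mulrDr ?mulrA//; exact: poly_funZ.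
Qed.

Lemma mulVf_fact (n : nat) (b x : R) : n`!%:R^-1 * (n`!%:R / b * x) = x / b.
Proof. by rewrite -mulrA mulKf 1?mulrC// pnatr_eq0 -lt0n fact_gt0. Qed.

Lemma corner_int_cst1 k c : 0 <= c ->
  corner_int c (fun _ : 'rV[R]_k => 1) = c ^+ k / k`!%:R.
Proof.
elim: k c => [|k IHk] c c0 /=; first by rewrite expr0 fact0 invr1 mulr1.
transitivity (poly_int c (k`!%:R^-1 *: ('X^0 * (c%:P - 'X) ^+ k))).
  apply: eq_Rintegral => t; rewrite inE/= in_itv/= => /andP[t0 tc].
  by rewrite IHk ?subr_ge0// hornerZ hornerM hornerXn horner_exp hornerD hornerN
    hornerC hornerX expr0 mul1r mulrC.
rewrite poly_intZ poly_int_beta// fact0 mul1n add0n.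
by rewrite mulVf_fact.
Qed.

(** The iterated integral treats the head coordinate differently from the others, yet the value is
    the same: the Beta integrals with exponents [(1, k)] and [(0, k + 1)] agree after division by
    [k!] and [(k + 1)!]. *)
Lemma corner_int_coord k c (i : 'I_k) : 0 <= c ->
  corner_int c (fun x : 'rV[R]_k => x 0 i) = c ^+ k.+1 / (k.+1)`!%:R.
Proof.
elim: k c i => [? []//|k IHk] c i c0.
rewrite corner_intS; case: (unliftP 0 i) => [j|] ->.
  transitivity (poly_int c ((k.+1)`!%:R^-1 *: ('X^0 * (c%:P - 'X) ^+ k.+1))).
    apply: eq_Rintegral => t; rewrite inE/= in_itv/= => /andP[t0 tc].
    under eq_corner_int do rewrite row_mx_const_lift.
    by rewrite IHk ?subr_ge0// hornerZ hornerM hornerXn horner_exp hornerD hornerN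
    hornerC hornerX expr0 mul1r mulrC.
  rewrite poly_intZ poly_int_beta// fact0 mul1n add0n.
  by rewrite mulVf_fact.
transitivity (poly_int c (k`!%:R^-1 *: ('X^1 * (c%:P - 'X) ^+ k))).
  apply: eq_Rintegral => t; rewrite inE/= in_itv/= => /andP[t0 tc].
  rewrite (@eq_corner_int _ _ _ (fun=> t * 1)); last first.
    by move=> y; rewrite row_mx_const0 mulr1.
  rewrite corner_intZ ?subr_ge0//; last exact: poly_fun_cst.
  by rewrite corner_int_cst1 ?subr_ge0// hornerZ hornerM hornerX horner_exp hornerD
    hornerN hornerC hornerX mulrA mulrC.
rewrite poly_intZ poly_int_beta// (mul1n k`!) add1n.
by rewrite mulVf_fact.
Qed.

End CornerIntegral.

(** * Powers and affine substitutions of polynomial functions *)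

Section PolynomialFunctions.
Variable R : realType.

Lemma poly_funX k (f : 'rV[R]_k -> R) e :
  poly_fun f -> poly_fun (fun x => f x ^+ e).
Proof.
move=> pf; elim: e => [|e IHe].
  rewrite (_ : (fun _ => _) = fun=> 1); first exact: poly_fun_cst.
  by apply/funext => x; rewrite expr0.
rewrite (_ : (fun _ => _) = fun x => f x * f x ^+ e); first exact: poly_funM.
by apply/funext => x; rewrite exprS.
Qed.

Lemma poly_fun_affine_coord k n (p0 : 'rV[R]_n) (E : 'M[R]_(k, n)) i :
  poly_fun (fun t : 'rV[R]_k => (p0 + t *m E) 0 i).
Proof.
rewrite (_ : (fun _ => _) = fun t : 'rV[R]_k => p0 0 i + \sum_j E j i * t 0 j).
  apply: poly_funD; first exact: poly_fun_cst.
  by apply: poly_fun_sum => j; apply: poly_funZ; exact: poly_fun_coord.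
apply/funext => t; rewrite !mxE; congr (_ + _).
by apply: eq_bigr => j _; rewrite mulrC.
Qed.

(** Needed because [simplex_int] pulls its integrand back along an affine map. Both the head
    coordinate and the remaining ones are affine in [t], so induction on [n] applies. *)
Lemma monomial_fun_comp_affine k n (m : 'rV[R]_n -> R) (p0 : 'rV[R]_n)
    (E : 'M[R]_(k, n)) :
  monomial_fun m -> poly_fun (fun t : 'rV[R]_k => m (p0 + t *m E)).
Proof.
elim: n m p0 E => [|n IHn] m p0 E /=.
  move=> m1; rewrite (_ : (fun _ => _) = fun=> 1); first exact: poly_fun_cst.
  by apply/funext => t; rewrite m1.
move=> [e [g [mg Eg]]].
pose p0' := @rsubmx R 1 1 n p0; pose E' := @rsubmx R k 1 n E.
rewrite (_ : (fun _ => _) = fun t => (p0 + t *m E) 0 0 ^+ e * g (p0' + t *m E')).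
  apply: poly_funM; last exact: IHn.
  exact/poly_funX/poly_fun_affine_coord.
apply/funext => t; set x := p0 + t *m E.
have -> : p0' + t *m E' = @rsubmx R 1 1 n x.
  by apply/rowP => j; rewrite !mxE; congr (_ + _); apply: eq_bigr => i _; rewrite !mxE.
rewrite -Eg; congr m; apply: etrans (esym (@hsubmxK R 1 1 n x)) _.
congr (row_mx _ _).
by apply/rowP => j; rewrite ord1 [LHS]mxE [RHS]mxE; congr (fun_of_matrix x 0 _);
  exact/val_inj.
Qed.

Lemma poly_fun_comp_affine k n (f : 'rV[R]_n -> R) (p0 : 'rV[R]_n)
    (E : 'M[R]_(k, n)) :
  poly_fun f -> poly_fun (fun t : 'rV[R]_k => f (p0 + t *m E)).
Proof.
elim=> [|a m {}f mm _ IHf]; first exact: poly_fun0.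
apply: poly_funD => //.
exact/poly_funZ/monomial_fun_comp_affine.
Qed.

Lemma poly_fun_dotv n (f g : 'rV[R]_n -> 'rV[R]_n) :
  (forall j, poly_fun (fun x => f x 0 j)) ->
  (forall j, poly_fun (fun x => g x 0 j)) ->
  poly_fun (fun x => dotv (f x) (g x)).
Proof. by move=> pf pg; apply: poly_fun_sum => j; exact: poly_funM. Qed.

End PolynomialFunctions.

(** * Linearity of simplex integrals and exact vertex quadrature *)

Section SimplexIntegral.
Variables (R : realType) (d k : nat) (p : seq 'rV[R]_d).
Implicit Types (f g : 'rV[R]_d -> R).

Lemma eq_simplex_int f g : f =1 g -> simplex_int k p f = simplex_int k p g.
Proof. by move=> /funext ->. Qed.

Lemma simplex_int_ge0 f : (forall x, 0 <= f x) -> 0 <= simplex_int k p f.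
Proof.
by move=> f0; rewrite mulr_ge0 ?sqrtr_ge0//; apply: corner_int_ge0.
Qed.

Lemma simplex_intD f g : poly_fun f -> poly_fun g ->
  simplex_int k p (fun x => f x + g x) = simplex_int k p f + simplex_int k p g.
Proof.
move=> pf pg; rewrite -mulrDr; congr (_ * _).
by rewrite corner_intD//; apply: poly_fun_comp_affine.
Qed.

Lemma simplex_intZ a f : poly_fun f ->
  simplex_int k p (fun x => a * f x) = a * simplex_int k p f.
Proof.
move=> pf; rewrite /simplex_int corner_intZ//; last exact: poly_fun_comp_affine.
by rewrite mulrCA.
Qed.

Lemma simplex_int_sum n (F : 'I_n -> 'rV[R]_d -> R) :
  (forall i, poly_fun (F i)) ->
  simplex_int k p (fun x => \sum_i F i x) = \sum_i simplex_int k p (F i).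
Proof.
move=> pF; elim: (index_enum _) => [|i r IHr].
  rewrite big_nil -[RHS](mul0r (simplex_int k p (fun=> 0))).
  rewrite -simplex_intZ; last exact: poly_fun0.
  by apply: eq_simplex_int => x; rewrite big_nil mul0r.
rewrite big_cons -IHr -simplex_intD//; last exact: poly_fun_sum.
by apply: eq_simplex_int => x; rewrite big_cons.
Qed.

Lemma simplex_int_cst a :
  simplex_int k p (fun=> a) = a * simplex_int k p (fun=> 1).
Proof.
rewrite -simplex_intZ; last exact: poly_fun_cst.
by apply: eq_simplex_int => x; rewrite mulr1.
Qed.

Lemma simplex_int1 :
  simplex_int k p (fun=> 1)
  = Num.sqrt (\det (edge_mx k p *m (edge_mx k p)^T)) / k`!%:R.
Proof. by rewrite /simplex_int corner_int_cst1// expr1n mul1r. Qed.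

(** All barycentric coordinates have the same mean [1 / (k + 1)], so the mean of an affine function
    is the average of its vertex values. *)
Lemma simplex_int_affine f (g : 'cV[R]_d) b : size p = k.+1 ->
  (forall x, f x = (x *m g) 0 0 + b) ->
  simplex_int k p f = simplex_int k p (fun=> 1) / k.+1%:R * \sum_(x <- p) f x.
Proof.
move=> sp Ef; rewrite simplex_int1 /simplex_int -!mulrA; congr (_ * _).
have -> : \sum_(x <- p) f x = k.+1%:R * f p`_0 + \sum_(i < k) (f p`_i.+1 - f p`_0).
  rewrite (big_nth 0) sp big_mkord big_ord_recl big_split/=.
  rewrite sumr_const card_ord mulNrn -mulr_natl -natr1.
  by move: (\sum_(_ < _) _) => S; ring.
transitivity (corner_int 1 (fun t : 'rV[R]_k =>
    f p`_0 * 1 + \sum_(i < k) (f p`_i.+1 - f p`_0) * t 0 i)).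
  apply: eq_corner_int => t; rewrite mulr1 Ef mulmxDl mxE -mulmxA.
  rewrite [f p`_0]Ef -!addrA; congr (_ + _); rewrite addrC; congr (_ + _).
  rewrite mxE; apply: eq_bigr => i _; rewrite mulrC; congr (_ * _).
  rewrite !Ef opprD addrACA subrr addr0 !mxE -sumrB.
  by apply: eq_bigr => j _; rewrite !mxE mulrBl.
rewrite corner_intD//; last first.
- by apply: poly_fun_sum => i; exact/poly_funZ/poly_fun_coord.
- exact/poly_funZ/poly_fun_cst.
rewrite corner_intZ//; last exact: poly_fun_cst.
rewrite corner_int_cst1// expr1n mul1r.
have -> : corner_int 1 (fun t : 'rV[R]_k =>
      \sum_(i < k) (f p`_i.+1 - f p`_0) * t 0 i)
    = \sum_(i < k) (f p`_i.+1 - f p`_0) / (k.+1)`!%:R.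
  elim: (index_enum _) => [|i r IHr].
    rewrite big_nil -[RHS](@corner_int0 R k 1).
    by apply: eq_corner_int => t; rewrite big_nil.
  have Hi : (k.+1)`!%:R^-1 = corner_int 1 (fun t : 'rV[R]_k => t 0 i).
    by rewrite corner_int_coord// expr1n mul1r.
  rewrite big_cons -IHr Hi -corner_intZ//; last exact: poly_fun_coord.
  rewrite -corner_intD//; last 2 first.
  - exact/poly_funZ/poly_fun_coord.
  - by apply: poly_fun_sum => j; exact/poly_funZ/poly_fun_coord.
  by apply: eq_corner_int => t; rewrite big_cons.
rewrite -mulr_suml factS natrM invfM.
have : k.+1%:R != 0 :> R by rewrite pnatr_eq0.
move: (\sum_(_ < _) _) k.+1%:R (k`!%:R^-1) => S n F n0.
by field.
Qed.

End SimplexIntegral.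

(** * Jacobians of affine maps *)

Section Jacobian.
Variables (R : realType) (d : nat).

Lemma continuous_mulmxr (A : 'M[R]_d) : continuous (mulmxr A : 'rV[R]_d -> _).
Proof.
rewrite (_ : (mulmxr A : 'rV[R]_d -> _) = fun x => \sum_i x 0 i *: row i A).
  elim: (index_enum _) => [|i r IHr] x.
    under eq_fun do rewrite big_nil; exact: cst_continuous.
  under eq_fun do rewrite big_cons.
  by apply: cvgD (IHr x); apply: cvgZr_tmp; exact: coord_continuous.
by apply/funext => x; rewrite /= mulmx_sum_row.
Qed.

Lemma jacobian_affine (g : 'rV[R]_d -> 'rV[R]_d) (A : 'M[R]_d) b x :
  (forall y, g y = y *m A + b) -> 'J g x = A.
Proof.
move=> Eg.
have -> : g = (mulmxr A : 'rV[R]_d -> _) \+ cst b.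
  by apply/funext => y; rewrite Eg.
have dA : differentiable (mulmxr A : 'rV[R]_d -> 'rV[R]_d) x.
  exact/linear_differentiable/continuous_mulmxr.
have EA : 'd (mulmxr A : 'rV[R]_d -> 'rV[R]_d) x = mulmxr A :> (_ -> _).
  exact/diff_lin/continuous_mulmxr.
apply/row_matrixP => i; rewrite /jacobian (diffD dA)//.
apply/rowP => j; rewrite 2!mxE.
have -> : ('d (mulmxr A : 'rV[R]_d -> 'rV[R]_d) x \+ 'd (cst b) x) (delta_mx 0 i)
    = delta_mx 0 i *m A.
  have := congr1 (fun f => f (delta_mx 0 i)) EA.
  have := congr1 (fun f => f (delta_mx 0 i)) (@diff_cst R 'rV[R]_d 'rV[R]_d b x).
  by move=> E1 E2; exact: etrans (congr2 +%R E2 E1) (addr0 _).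
by rewrite -rowE mxE.
Qed.

End Jacobian.

(** * Algebra of the Euclidean dot product *)

Section DotProduct.
Variables (R : realType) (d : nat).
Implicit Types u v w : 'rV[R]_d.

Lemma dotvC u v : dotv u v = dotv v u.
Proof. by apply: eq_bigr => j _; rewrite mulrC. Qed.

Lemma dotvDl u v w : dotv (u + v) w = dotv u w + dotv v w.
Proof. by rewrite -big_split; apply: eq_bigr => j _; rewrite mxE mulrDl. Qed.

Lemma dotvDr u v w : dotv w (u + v) = dotv w u + dotv w v.
Proof. by rewrite dotvC dotvDl !(dotvC w). Qed.

Lemma dotvZl a u v : dotv (a *: u) v = a * dotv u v.
Proof. by rewrite /dotv mulr_sumr; apply: eq_bigr => j _; rewrite mxE mulrA. Qed.

Lemma dotvZr a u v : dotv u (a *: v) = a * dotv u v.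
Proof. by rewrite dotvC dotvZl dotvC. Qed.

Lemma dotvNl u v : dotv (- u) v = - dotv u v.
Proof. by rewrite -scaleN1r dotvZl mulN1r. Qed.

Lemma dotvBl u v w : dotv (u - v) w = dotv u w - dotv v w.
Proof. by rewrite dotvDl dotvNl. Qed.

Lemma dotvBr u v w : dotv w (u - v) = dotv w u - dotv w v.
Proof. by rewrite dotvC dotvBl !(dotvC w). Qed.

Lemma dotv0l u : dotv 0 u = 0.
Proof. by rewrite -(scale0r 0) dotvZl mul0r. Qed.

Lemma dotv0r u : dotv u 0 = 0.
Proof. by rewrite dotvC dotv0l. Qed.

Lemma dotv_ge0 u : 0 <= dotv u u.
Proof. by apply: sumr_ge0 => j _; rewrite -expr2 sqr_ge0. Qed.

Lemma dotv_suml (I : Type) (r : seq I) (P : pred I) (F : I -> 'rV[R]_d) v :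
  dotv (\sum_(i <- r | P i) F i) v = \sum_(i <- r | P i) dotv (F i) v.
Proof.
elim/big_rec2: _ => [|i y x _ <-]; first exact: dotv0l.
by rewrite dotvDl.
Qed.

Lemma dotvE u v : dotv u v = (u *m v^T) 0 0.
Proof. by rewrite mxE; apply: eq_bigr => j _; rewrite mxE. Qed.

Lemma mulmx_tr_dotv m n (A : 'M[R]_(m, d)) (B : 'M[R]_(n, d)) i j :
  (A *m B^T) i j = dotv (row i A) (row j B).
Proof. by rewrite mxE; apply: eq_bigr => l _; rewrite !mxE. Qed.

End DotProduct.

(** * The volume of a simplex as base times height *)

Section SimplexVolume.
Variable R : realType.

Lemma row_edge_mx d k (p : seq 'rV[R]_d) i :
  row i (edge_mx k p) = p`_i.+1 - p`_0.
Proof. by apply/rowP => j; rewrite !mxE. Qed.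

(* The matrix of homogeneous vertex coordinates treats all vertices alike, so
   that relabelling them only permutes its rows. *)
Lemma det_edge_mxE d (p : seq 'rV[R]_d) :
  \det (edge_mx d p)
  = \det (\matrix_(i < 1 + d) row_mx (1 : 'rV[R]_1) p`_i : 'M[R]_(1 + d)).
Proof.
have -> : \matrix_(i < 1 + d) row_mx (1 : 'rV[R]_1) p`_i
    = block_mx (1 : 'M[R]_1) 0 (const_mx 1 : 'M[R]_(d, 1)) 1%:M
      *m block_mx (1 : 'M[R]_1) p`_0 0 (edge_mx d p).
  rewrite mulmx_block !mul1mx !mul0mx !addr0 ?mulmx1 ?mulmx0 ?addr0.
  apply/row_matrixP => i; rewrite rowK /block_mx.
  case: (split_ordP i) => j ->.
    by rewrite rowKu ord1 row_row_mx !row_id.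
  rewrite rowKd row_row_mx; congr row_mx.
    by apply/rowP => l; rewrite ord1 !mxE.
  rewrite raddfD/= row_edge_mx row_mul.
  have -> : row j (const_mx 1 : 'M[R]_(d, 1)) = 1%:M.
    by apply/rowP => l; rewrite ord1 !mxE eqxx.
  by rewrite mul1mx addrC subrK.
by rewrite det_mulmx det_lblock det_ublock !det1 !mul1r.
Qed.

(** The enumeration of a vertex set is arbitrary, whereas the base-height formula needs a base
    vertex first and the apex second. Squaring removes the sign of the reordering. *)
Lemma sqr_det_edge_mx_perm d (p q : seq 'rV[R]_d) : size p = d.+1 ->
  perm_eq p q -> \det (edge_mx d p) ^+ 2 = \det (edge_mx d q) ^+ 2.
Proof.
move=> sp pq; have sq : size q == d.+1 by rewrite -(perm_size pq) sp.
have /tuple_permP[s Es] : perm_eq p (Tuple sq) by [].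
rewrite !det_edge_mxE.
have -> : \matrix_(i < 1 + d) row_mx (1 : 'rV[R]_1) p`_i
    = row_perm s (\matrix_(i < 1 + d) row_mx (1 : 'rV[R]_1) q`_i).
  apply/row_matrixP => i; rewrite rowK.
  have -> : row i (row_perm s (\matrix_(i < 1 + d) row_mx (1 : 'rV[R]_1) q`_i))
      = row_mx (1 : 'rV[R]_1) q`_(s i).
    by apply/rowP => j; rewrite !mxE.
  congr row_mx.
  by rewrite Es -tnth_nth tnth_mktuple (tnth_nth 0).
rewrite row_permE det_mulmx det_perm exprMn.
by rewrite -signr_odd; case: (odd _); rewrite ?expr0 ?expr1 ?sqrrN !expr1n mul1r.
Qed.

(** Replacing the edge to the apex by the unit normal gives a matrix [N] with block diagonal Gram
    matrix, the blocks being [1] and the Gram matrix of the base. Passing from the edges to [N]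
    multiplies the determinant by the apex coefficient of [n], which is the inverse of the signed
    height. *)
Lemma sqrt_det_gram_apex m (x0 xa n : 'rV[R]_m.+1) (s q : seq 'rV[R]_m.+1) :
  size s = m -> perm_eq q [:: x0, xa & s] -> row_free (edge_mx m.+1 q) ->
  dotv n n = 1 -> (forall y, y \in s -> dotv (y - x0) n = 0) ->
  Num.sqrt (\det (edge_mx m.+1 q *m (edge_mx m.+1 q)^T))
  = `|dotv (xa - x0) n|
    * Num.sqrt (\det (edge_mx m (x0 :: s) *m (edge_mx m (x0 :: s))^T)).
Proof.
move=> ss pq fq n1 sn; set q' := [:: x0, xa & s] in pq.
have sq : size q = m.+2 by rewrite (perm_size pq)/= ss.
have Eq : edge_mx m.+1 q' = col_mx (xa - x0) (edge_mx m (x0 :: s))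
    :> 'M[R]_(1 + m, m.+1).
  apply/row_matrixP => i; rewrite row_edge_mx.
  case: (split_ordP i) => j ->; first by rewrite rowKu ord1 row_id.
  by rewrite rowKd row_edge_mx.
set E := edge_mx m (x0 :: s) in Eq *.
pose N : 'M[R]_(1 + m) := col_mx n E.
have detq : \det (edge_mx m.+1 q) ^+ 2 = \det (edge_mx m.+1 q') ^+ 2.
  exact: sqr_det_edge_mx_perm.
have uq : edge_mx m.+1 q' \in unitmx.
  rewrite unitmxE unitfE -sqrf_eq0 -detq sqrf_eq0 -unitfE -unitmxE.
  by rewrite -row_free_unit.
have En : E *m n^T = 0.
  apply/colP => i; rewrite mulmx_tr_dotv row_edge_mx/= row_id mxE sn//.
  by rewrite mem_nth// ss.
have NN : \det (N *m N^T) = \det (E *m E^T).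
  rewrite tr_col_mx mul_col_row En.
  rewrite -[n *m E^T]trmxK trmx_mul trmxK En trmx0 det_ublock.
  by rewrite det_mx11 -dotvE n1 mul1r.
(* [lc] holds the coordinates of [n] in the basis of edges. Pairing that expansion with [n] kills
   the base edges, so the first coordinate times the signed height is 1. *)
pose lc : 'M[R]_(1, 1 + m) := n *m invmx (edge_mx m.+1 q').
have Elc : n = lc *m edge_mx m.+1 q' by rewrite mulmxKV.
have EN : N = block_mx (lsubmx lc) (rsubmx lc) 0 1%:M *m edge_mx m.+1 q'.
  rewrite /N {1}Elc Eq -{1}(hsubmxK lc) mul_block_col mul0mx mul1mx add0r.
  by rewrite mul_row_col.
have Elc2 : n = lsubmx lc *m (xa - x0) + rsubmx lc *m E.
  by rewrite {1}Elc Eq -{1}(hsubmxK lc) mul_row_col.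
have lh : lsubmx lc 0 0 * dotv (xa - x0) n = 1.
  have : dotv (lsubmx lc *m (xa - x0) + rsubmx lc *m E) n = 1 by rewrite -Elc2.
  rewrite (dotvDl _ (rsubmx lc *m E)) (dotvE (rsubmx lc *m E)).
  rewrite -mulmxA En mulmx0 [X in _ + X]mxE addr0.
  by rewrite dotvE -mulmxA [LHS]mxE big_ord1 -dotvE.
have : \det (N *m N^T) = (lsubmx lc 0 0 * \det (edge_mx m.+1 q')) ^+ 2.
  by rewrite det_mulmx det_tr EN det_mulmx det_ublock det1 mulr1 det_mx11.
rewrite NN => ->; rewrite sqrtr_sqr det_mulmx det_tr -expr2 detq sqrtr_sqr.
by rewrite -normrM mulrA [dotv _ _ * _]mulrC lh mul1r.
Qed.

End SimplexVolume.

(** * Heights, barycentric gradients and the divergence theorem on one cell *)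

Section MeshGeometry.
Variables (R : realType) (m : nat) (M : mesh R m.+1).
Hypothesis cm : conforming_mesh M.
Local Notation d := m.+1.
Implicit Types (S E : {set 'I_(nvertices M)}) (T : 'I_(ncells M)).

Lemma size_points S : size (points S) = #|S|.
Proof. by rewrite size_map -cardE. Qed.

Lemma mem_pointsP S x : reflect (exists2 b, b \in S & x = vtx b) (x \in points S).
Proof.
apply: (iffP mapP) => -[b bS ->]; exists b => //; move: bS; by rewrite mem_enum.
Qed.

(** The edges of a nondegenerate cell span the space. Testing on all vertex differences avoids
    singling out a base vertex. *)
Lemma cell_mx_inj T r (B C : 'M[R]_(d, r)) :
  (forall b c, b \in cell T -> c \in cell T ->
     (vtx b - vtx c) *m B = (vtx b - vtx c) *m C) -> B = C.
Proof.
move=> BC; have := cell_nondegenerate cm T; rewrite row_free_unit => uT.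
rewrite -(mulKmx uT B) -(mulKmx uT C); congr (_ *m _).
apply/row_matrixP => i; rewrite !row_mul row_edge_mx.
have mem j : (j <= d)%N -> exists2 b, b \in cell T & (points (cell T))`_j = vtx b.
  by move=> jd; apply/mem_pointsP; rewrite mem_nth// size_points (card_cell cm).
have [b bT ->] := mem i.+1 (ltn_ord i).
have [c cT ->] := mem 0%N isT.
exact: BC.
Qed.

(** On a face this is the signed distance to its plane: any vertex of the face serves as origin,
    since the normal is orthogonal to the face. The default 0 only occurs for an empty [E]. *)
Definition height E (x : 'rV[R]_d) : R :=
  dotv x (face_normal E)
  - (if [pick b in E] is Some b then dotv (vtx b) (face_normal E) else 0).

Lemma heightB E x y :
  height E x - height E y = dotv (x - y) (face_normal E).
Proof. by rewrite /height dotvBl opprB addrA subrK. Qed.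

Lemma height_face E b : E \in faces M -> b \in E -> height E (vtx b) = 0.
Proof.
move=> Ef bE; rewrite /height; case: pickP => [c cE|/(_ b)]; last by rewrite bE.
by rewrite -dotvBl (normal_orthogonal cm).
Qed.

Lemma card_face E : E \in faces M -> #|E| = d.
Proof. by rewrite inE => /andP[/eqP]. Qed.

Lemma face_neq0 E : E \in faces M -> exists b, b \in E.
Proof. by move=> Ef; apply/set0Pn; rewrite -card_gt0 card_face. Qed.

Lemma cell_face T a : a \in cell T -> cell T :\ a \in faces M.
Proof.
move=> aT; rewrite inE; apply/andP; split.
  by have := cardsD1 a (cell T); rewrite aT (card_cell cm) add1n => /succn_inj <-.
by apply/card_gt0P; exists T; rewrite inE subD1set.
Qed.

Lemma neighbor_apex E T : E \in faces M -> T \in neighbors E ->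
  exists2 a, a \in cell T & E = cell T :\ a.
Proof.
move=> Ef; rewrite inE => ET.
have : #|cell T :\: E| == 1%N.
  by rewrite cardsD (finset.setIidPr ET) (card_cell cm) (card_face Ef) subSnn.
move=> /cards1P[a Ea]; have : a \in cell T :\: E by rewrite Ea inE.
rewrite inE => /andP[aE aT]; exists a => //.
by rewrite -Ea finset.setDDr finset.setDv finset.set0U (finset.setIidPr ET).
Qed.

Lemma normal_sqr E : E \in faces M -> dotv (face_normal E) (face_normal E) = 1.
Proof.
move=> Ef; rewrite -[LHS]sqr_sqrtr ?dotv_ge0//.
by have := normal_unit cm Ef; rewrite /enorm => ->; rewrite expr1n.
Qed.

(** Otherwise the height vanishes at every vertex of the cell, so the normal is orthogonal to all
    edges and is zero, against its unit length. *)
Lemma height_apex_neq0 T a : a \in cell T ->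
  height (cell T :\ a) (vtx a) != 0.
Proof.
move=> aT; set E := cell T :\ a; have Ef := cell_face aT.
apply/eqP => h0; suff n0 : (face_normal E)^T = 0.
  have := normal_sqr Ef; rewrite -[face_normal E]trmxK n0 trmx0 dotv0l.
  by move/eqP; rewrite eq_sym oner_eq0.
apply: (@cell_mx_inj T) => b c bT cT; rewrite mulmx0; apply/rowP => j.
rewrite ord1 -dotvE -heightB mxE.
have h x : x \in cell T -> height E (vtx x) = 0.
  move=> xT; have [->//|xa] := eqVneq x a.
  by rewrite height_face// !inE xa.
by rewrite !h// subrr.
Qed.

Lemma outward_apex T a : a \in cell T ->
  outward (cell T :\ a) T = (height (cell T :\ a) (vtx a) < 0).
Proof.
move=> aT; set E := cell T :\ a; have Ef := cell_face aT.
have [b0 b0E] := face_neq0 Ef.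
apply/forall_inP/idP => [/(_ a)|ha c].
  rewrite !inE eqxx aT => /(_ isT)/forall_inP/(_ b0 b0E).
  by rewrite -heightB (height_face Ef b0E) subr0.
rewrite !inE => /andP[+ cT]; rewrite cT andbT negbK => /eqP ->.
by apply/forall_inP => b bE; rewrite -heightB (height_face Ef bE) subr0.
Qed.

Lemma inward_apex T a : a \in cell T ->
  inward (cell T :\ a) T = (0 < height (cell T :\ a) (vtx a)).
Proof.
move=> aT; set E := cell T :\ a; have Ef := cell_face aT.
have [b0 b0E] := face_neq0 Ef.
apply/forall_inP/idP => [/(_ a)|ha c].
  rewrite !inE eqxx aT => /(_ isT)/forall_inP/(_ b0 b0E).
  by rewrite -heightB (height_face Ef b0E) subr0.
rewrite !inE => /andP[+ cT]; rewrite cT andbT negbK => /eqP ->.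
by apply/forall_inP => b bE; rewrite -heightB (height_face Ef bE) subr0.
Qed.

Lemma inward_outwardN E T : E \in faces M -> T \in neighbors E ->
  inward E T = ~~ outward E T.
Proof.
move=> Ef /(neighbor_apex Ef)[a aT ->].
rewrite outward_apex// inward_apex// -leNgt le_eqVlt eq_sym.
by rewrite (negPf (height_apex_neq0 aT)).
Qed.

(* The gradient of the barycentric coordinate of [T] attached to [a]. *)
Definition bary_grad T a : 'rV[R]_d :=
  (height (cell T :\ a) (vtx a))^-1 *: face_normal (cell T :\ a).

Lemma bary_gradE T a b c : a \in cell T -> b \in cell T -> c \in cell T ->
  dotv (vtx b - vtx c) (bary_grad T a) = (b == a)%:R - (c == a)%:R.
Proof.
move=> aT bT cT; have Ef := cell_face aT; rewrite dotvZr -heightB.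
have h x : x \in cell T -> height (cell T :\ a) (vtx x)
    = (x == a)%:R * height (cell T :\ a) (vtx a).
  move=> xT; have [->|xa] := eqVneq x a; first by rewrite mul1r.
  by rewrite mul0r height_face// !inE xa.
by rewrite (h b)// (h c)// -mulrBl mulrCA mulVf ?mulr1// height_apex_neq0.
Qed.

(** An affine map is the sum of its vertex values times barycentric coordinates; this is the
    gradient of that identity. The hypothesis on differences makes the translation part
    disappear. *)
Lemma cell_interpolation T r (g : 'rV[R]_d -> 'rV[R]_r) (A : 'M[R]_(d, r)) :
  (forall x y, g x - g y = (x - y) *m A) ->
  A = \sum_(a in cell T) (bary_grad T a)^T *m g (vtx a).
Proof.
move=> gA; apply: (@cell_mx_inj T) => b c bT cT.
rewrite -gA mulmx_sumr.
have delta x : x \in cell T ->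
    \sum_(a in cell T) (x == a)%:R *: g (vtx a) = g (vtx x).
  move=> xT; rewrite (bigD1 x)//= eqxx scale1r big1 ?addr0// => a /andP[_ ax].
  by rewrite eq_sym (negPf ax) scale0r.
rewrite -(delta b)// -(delta c)// -sumrB; apply: eq_bigr => a aT.
rewrite mulmxA; apply/rowP => j.
by rewrite [RHS]mxE big_ord1 -dotvE bary_gradE// !mxE mulrBl.
Qed.

(** Interpolation of the constant 1: barycentric coordinates form a partition of unity. *)
Lemma sum_bary_grad T : \sum_(a in cell T) bary_grad T a = 0.
Proof.
have := @cell_interpolation T 1 (fun=> 1) 0.
rewrite -mulmx_suml mulmx1 -raddf_sum => H.
apply: trmx_inj; rewrite trmx0 -H// => x y.
by rewrite subrr mulmx0.
Qed.

(** The factor [d] is the quotient of the factorials [d!] and [(d - 1)!] in the volumes of the two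
    reference corners. *)
Lemma cell_volume_apex T a : a \in cell T ->
  d%:R * cell_int T (fun=> 1)
  = `|height (cell T :\ a) (vtx a)| * face_int (cell T :\ a) (fun=> 1).
Proof.
move=> aT; set E := cell T :\ a; have Ef := cell_face aT.
rewrite /cell_int /face_int !simplex_int1/=.
have := card_face Ef; rewrite cardE.
case Es : (enum E) => [//|e s] [ss].
have eE : e \in E by rewrite -mem_enum Es mem_head.
have pE : points E = vtx e :: [seq vtx i | i <- s] by rewrite /points Es.
(* Reordering with a face vertex first and the apex second matches the shape of
   [sqrt_det_gram_apex]. *)
have pT : perm_eq (points (cell T)) [:: vtx e, vtx a & [seq vtx i | i <- s]].
  rewrite -[_ :: _]/(map (@vtx _ _ M) [:: e, a & s]); apply: perm_map.
  have us : uniq (e :: s) by rewrite -Es enum_uniq.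
  have aE : a \notin e :: s by rewrite -Es mem_enum !inE eqxx.
  rewrite perm_sym; apply: uniq_perm; rewrite ?enum_uniq//=.
    move: us aE; rewrite /= [a \in _]inE negb_or => /andP[es ->] /andP[ae ->].
    by rewrite inE negb_or eq_sym ae es.
  move=> x; rewrite mem_enum.
  have -> : (x \in [:: e, a & s]) = (x == a) || (x \in e :: s).
    by rewrite !inE orbCA.
  by rewrite -Es mem_enum !inE; have [->|] := eqVneq x a; rewrite ?aT.
have := sqrt_det_gram_apex _ pT (cell_nondegenerate cm T) (normal_sqr Ef).
rewrite size_map ss => /(_ erefl) ->; last first.
  move=> y /mapP[b bs ->]; rewrite (normal_orthogonal cm)//.
  by rewrite -mem_enum Es inE bs orbT.
rewrite pE -heightB (height_face Ef eE) subr0 factS natrM invfM.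
rewrite -!mulrA mulrCA; congr (_ * _); rewrite mulrCA; congr (_ * _).
by rewrite mulrA divff ?mul1r// pnatr_eq0.
Qed.

(** For a neighbor [T] of [E], this sign turns the fixed normal of the face into the outward normal
    of [T]. *)
Definition face_sgn E T : R := if outward E T then 1 else -1.

Lemma face_int_affine E (g : 'rV[R]_d -> 'rV[R]_d) (c : 'rV[R]_d) :
  E \in faces M -> affine g ->
  face_int E (fun x => dotv c (g x))
  = face_int E (fun=> 1) / d%:R * \sum_(b in E) dotv c (g (vtx b)).
Proof.
move=> Ef [A [b Eg]].
rewrite /face_int (@simplex_int_affine _ _ _ _ _ (A *m c^T) (dotv c b)).
- by congr (_ * _); rewrite big_map big_enum.
- by rewrite size_points card_face.
- by move=> x; rewrite Eg dotvDr dotvC dotvE mulmxA.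
Qed.

(** Vertex quadrature on the face opposite [a] gives [- V] times the sum of [F a c] over the
    vertices [c] other than [a]. Summed over all pairs [(a, c)], [F] gives 0 because the barycentric
    gradients add up to 0, so only the diagonal remains, and [cell_interpolation] identifies it with
    [frob sigma A]. *)
Lemma cell_divergence T (sigma : 'M[R]_d) (g : 'rV[R]_d -> 'rV[R]_d)
    (A : 'M[R]_d) (b : 'rV[R]_d) : (forall x, g x = x *m A + b) ->
  \sum_(a in cell T) face_sgn (cell T :\ a) T
    * face_int (cell T :\ a)
        (fun x => dotv (face_normal (cell T :\ a) *m sigma) (g x))
  = cell_int T (fun=> 1) * frob sigma A.
Proof.
move=> Eg; set V := cell_int T _.
pose F a (c : 'I_(nvertices M)) := dotv (bary_grad T a *m sigma) (g (vtx c)).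
have -> : frob sigma A = \sum_(a in cell T) F a a.
  rewrite (@cell_interpolation T _ g A); last first.
    by move=> x y; rewrite !Eg opprD addrACA subrr addr0 mulmxBl.
  rewrite /frob; under eq_bigr do under eq_bigr do rewrite summxE mulr_sumr.
  under eq_bigr do rewrite exchange_big; rewrite exchange_big/=.
  apply: eq_bigr => a _; rewrite exchange_big/=; apply: eq_bigr => j _.
  rewrite [(_ *m sigma) _ _]mxE mulr_suml; apply: eq_bigr => i _.
  by rewrite mxE big_ord1 mxE mulrCA mulrA.
transitivity (\sum_(a in cell T) - (V * \sum_(c in cell T :\ a) F a c)).
  apply: eq_bigr => a aT; have Ef := cell_face aT.
  rewrite face_int_affine//; last by exists A, b.
  rewrite /face_sgn outward_apex// /F /bary_grad.
  have := height_apex_neq0 aT; have := cell_volume_apex aT; rewrite -/V.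
  set h := height _ _; set fE := face_int _ _; set n := face_normal _ => EV h0.
  under [in RHS]eq_bigr do rewrite -scalemxAl dotvZl.
  rewrite -mulr_sumr; move: (\sum_(_ in _) _) => s.
  have d0 : d%:R != 0 :> R by rewrite pnatr_eq0.
  have -> : V = `|h| * fE / d%:R by rewrite -EV mulrC mulKf.
  have [hn|hp] := ltP h 0.
    by rewrite ltr0_norm//; move: d%:R d0 => N d0; field; rewrite d0 h0.
  by rewrite ger0_norm//; move: d%:R d0 => N d0; field; rewrite d0 h0.
rewrite sumrN -mulr_sumr -mulrN; congr (_ * _); rewrite -sumrN.
have H a : a \in cell T ->
    - \sum_(c in cell T :\ a) F a c = F a a - \sum_(c in cell T) F a c.
  by move=> aT; rewrite (big_setD1 a aT)/= opprD addrA subrr sub0r.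
rewrite (eq_bigr _ H) sumrB [X in _ - X]exchange_big/= [X in _ - X]big1 ?subr0// => c _.
by rewrite /F -dotv_suml -mulmx_suml sum_bary_grad mul0mx dotv0l.
Qed.

End MeshGeometry.

(** * Neighbors of a face and the passage from cells to faces *)

Section MeshTopology.
Variables (R : realType) (m : nat) (M : mesh R m.+1).
Hypothesis cm : conforming_mesh M.
Local Notation d := m.+1.
Implicit Types (S E : {set 'I_(nvertices M)}) (T : 'I_(ncells M)).

Lemma height_comb E (w : 'I_(nvertices M) -> R) : \sum_i w i = 1 ->
  height E (\sum_i w i *: vtx i) = \sum_i w i * height E (vtx i).
Proof.
move=> w1; rewrite /height; set c := (X in _ - X).
under [RHS]eq_bigr do rewrite mulrBr.
rewrite sumrB -mulr_suml w1 mul1r dotv_suml; congr (_ - _).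
by apply: eq_bigr => i _; rewrite dotvZl.
Qed.

(* If two cells lay on the same side of a common face, a point slightly off the
   barycenter of the face would belong to both cells, but not to the face. *)
Lemma neighbors_outward_inj E : E \in faces M ->
  {in neighbors E &, injective (outward E)}.
Proof.
move=> Ef T T' TE T'E ho; apply/eqP/negPn/negP => TT'.
have [a aT Ea] := neighbor_apex cm Ef TE.
have [a' a'T Ea'] := neighbor_apex cm Ef T'E.
(* A common vertex off [E] would be the apex of both cells, which would then have the same
   vertices. *)
have capE : (cell T :&: cell T' = E)%SET.
  apply/setP => x; rewrite inE; apply/andP/idP => [[xT xT']|xE]; last first.
    by split; [move: xE; rewrite Ea|move: xE; rewrite Ea']; rewrite !inE => /andP[].
  apply: contraNT TT' => xE.
  have xa : x = a by apply: contraNeq xE; rewrite Ea !inE xT andbT.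
  have xa' : x = a' by apply: contraNeq xE; rewrite Ea' !inE xT' andbT.
  apply/eqP/(cell_inj cm).
  by rewrite -(finset.setD1K aT) -(finset.setD1K a'T) -Ea -Ea' -xa -xa'.
have aE : a \notin E by rewrite Ea !inE eqxx.
have a'E : a' \notin E by rewrite Ea' !inE eqxx.
have dE : \sum_i (i \in E)%:R / d%:R = 1 :> R.
  rewrite -mulr_suml; have -> : \sum_i (i \in E)%:R = d%:R :> R.
    rewrite -[in RHS](card_face Ef) -sum1_card natr_sum [RHS]big_mkcond/=.
    by apply: eq_bigr => i _; case: (i \in E).
  by rewrite divff// pnatr_eq0.
have hE b : b \in E -> height E (vtx b) = 0 by exact: height_face.
pose c := \sum_i ((i \in E)%:R / d%:R) *: vtx i : 'rV[R]_d.
have hc : height E c = 0.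
  rewrite height_comb// big1// => i _.
  by have [/hE ->|_] := boolP (i \in E); rewrite ?mulr0// mul0r mul0r.
have ha0 : height E (vtx a) != 0 by rewrite {1}Ea height_apex_neq0.
have ha'0 : height E (vtx a') != 0 by rewrite {1}Ea' height_apex_neq0.
have r0 : 0 < (height E (vtx a))^-1 * height E (vtx a').
  move: ho; rewrite {1}Ea {1}Ea' !outward_apex// -Ea -Ea'.
  case: (ltgtP (height E (vtx a)) 0) ha0 => //;
    case: (ltgtP (height E (vtx a')) 0) ha'0 => // h' _ h _ _.
    by rewrite nmulr_rgt0// invr_lt0.
  by rewrite mulr_gt0// invr_gt0.
(* The rate of change of the barycentric coordinate [b] of [T] on the way from the barycenter [c] to
   [vtx a']. For the apex [a] it is the quotient of the two heights, positive by [r0]. *)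
pose mu b := dotv (vtx a' - c) (bary_grad T b).
pose S := \sum_(b in cell T) `|mu b|.
have S0 : 0 <= S by apply: sumr_ge0.
(* A step of length [e] lowers a coordinate by at most [e * S <= 1 / d], which the starting value
   [1 / d] at [c] absorbs. The summand 1 keeps [e] defined when [S = 0] and at most 1. *)
pose e := (d%:R * (1 + S))^-1.
have d1 : 1 <= d%:R :> R by rewrite ler1n.
have e0 : 0 < e by rewrite invr_gt0 mulr_gt0 ?(lt_le_trans ltr01 d1)// ltr_wpDr.
have e1 : e <= 1.
  rewrite invf_le1 ?mulr_gt0 ?(lt_le_trans ltr01 d1)// ?ltr_wpDr//.
  by rewrite mulr_ege1// lerDl.
have eS : e * S <= d%:R^-1.
  rewrite /e invfM -mulrA ler_piMr ?invr_ge0 ?ler0n// mulrC.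
  by rewrite ler_pdivrMr ?ltr_wpDr// mul1r lerDr.
(* Two representations of one point: [w] gives its barycentric coordinates in [T], and [w'] those of
   [(1 - e) c + e (vtx a')] in [T']. *)
pose w b := if b \in cell T then (b \in E)%:R / d%:R + e * mu b else 0.
pose w' b := (b \in E)%:R / d%:R * (1 - e) + (b == a')%:R * e.
have sw' : \sum_i w' i = 1.
  rewrite big_split/= -mulr_suml dE mul1r -mulr_suml.
  by rewrite (bigD1 a')//= eqxx big1 ?addr0 ?mul1r ?subrK// => i /negPf ->.
pose y := \sum_i w' i *: vtx i : 'rV[R]_d.
have Ey : y = c + e *: (vtx a' - c).
  rewrite /y (eq_bigr (fun i => (1 - e) *: (((i \in E)%:R / d%:R) *: vtx i)
      + ((i == a')%:R * e) *: vtx i)); last first.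
    by move=> i _; rewrite /w' scalerDl scalerA [(1 - e) * _]mulrC.
  rewrite big_split/= -scaler_sumr -/c.
  rewrite (bigD1 a')//= eqxx mul1r big1 ?addr0; last first.
    by move=> i /negPf ->; rewrite mul0r scale0r.
  by rewrite scalerBl scale1r scalerBr addrA addrAC.
have yT' : hull (cell T') y.
  exists w'; split=> //.
  - move=> i; rewrite addr_ge0// mulr_ge0 ?(ltW e0)// ?subr_ge0//.
  - move=> i iT'; have iE : (i \in E) = false.
      by apply: contraNF iT'; rewrite Ea' !inE => /andP[].
    have ia' : (i == a') = false by apply: contraNF iT' => /eqP ->.
    by rewrite /w' iE ia' !mul0r addr0.
have yT : hull (cell T) y.
  (* Stated for any module: the constant [F = 1] shows that the weights add up to 1, and [F = vtx]
     that they represent [y]. *)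
  have sumT (V : lmodType R) (F : 'I_(nvertices M) -> V) :
      \sum_i w i *: F i = \sum_i ((i \in E)%:R / d%:R) *: F i
        + e *: \sum_(b in cell T) mu b *: F b.
    rewrite [\sum_(b in cell T) _]big_mkcond/= scaler_sumr -big_split/=.
    apply: eq_bigr => i _; rewrite /w; case: ifPn => iT.
      by rewrite scalerDl scalerA.
    rewrite scale0r scaler0 addr0; have -> : (i \in E) = false.
      by apply: contraNF iT; rewrite Ea !inE => /andP[].
    by rewrite mul0r scale0r.
  exists w; split.
  - move=> b; rewrite /w; case: ifPn => // bT.
    have [bE|bE] := boolP (b \in E).
      have : e * `|mu b| <= d%:R^-1.
        apply: le_trans eS; rewrite ler_wpM2l ?(ltW e0)//.
        by rewrite /S (bigD1 b)//= lerDl sumr_ge0.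
      rewrite mul1r -(ger0_norm (ltW e0)) -normrM ler_norml => /andP[+ _].
      by rewrite (ger0_norm (ltW e0)) -lerBlDl sub0r.
    rewrite mul0r add0r mulr_ge0 ?(ltW e0)//.
    have -> : b = a by apply: contraNeq bE => ba; rewrite Ea !inE ba.
    by rewrite /mu /bary_grad -Ea dotvZr -heightB hc subr0 ltW.
  - by move=> i /negPf iT; rewrite /w iT.
  - have := sumT R^o (fun=> 1); rewrite /GRing.scale/= => H.
    under eq_bigr do rewrite -[w _]mulr1.
    rewrite H; under eq_bigr do rewrite mulr1; rewrite dE.
    under eq_bigr do rewrite mulr1.
    rewrite [X in _ * X](_ : _ = 0) ?mulr0 ?addr0// /mu.
    under eq_bigr do rewrite dotvC.
    by rewrite -dotv_suml sum_bary_grad// dotv0l.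
  - rewrite sumT -/c Ey; congr (_ + _ *: _).
    rewrite -[LHS]mulmx1 (@cell_interpolation _ _ _ cm T _ id 1%:M); last first.
      by move=> u v; rewrite mulmx1.
    rewrite mulmx_sumr; apply: eq_bigr => b _; apply/rowP => j.
    by rewrite mulmxA [LHS]mxE big_ord1 -dotvE mxE.
have := no_hanging_nodes cm TT'; rewrite capE => /seteqP[+ _] => /(_ y (conj yT yT')).
case=> v [v0 vE v1 yE].
(* As a point of [E], [y] has height 0, while its [w'] representation gives the nonzero height
   [e * height E (vtx a')]. *)
have : height E y = 0.
  rewrite yE height_comb// big1// => i _.
  by have [/hE ->|/vE ->] := boolP (i \in E); rewrite ?mulr0// mul0r.
rewrite /y height_comb// (bigD1 a')//= big1; last first.
  move=> i /negPf ia'; rewrite /w' ia'.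
  by have [/hE ->|_] := boolP (i \in E); rewrite ?mulr0// !mul0r addr0 mul0r.
rewrite addr0 /w' eqxx (negPf a'E) !mul0r add0r mul1r => /eqP.
by rewrite mulf_eq0 (gt_eqF e0) (negPf ha'0).
Qed.

(** [outward E] embeds the neighbors into [bool], so there are at most two. *)
Lemma face_interior_or_boundary E : E \in faces M ->
  (E \in interior_faces M) || (E \in boundary_faces M).
Proof.
move=> Ef; rewrite [E \in interior_faces M]inE [E \in boundary_faces M]inE Ef/=.
have := max_card (mem (outward E @: neighbors E)).
rewrite card_in_imset; last exact: (neighbors_outward_inj Ef).
rewrite card_bool; move: Ef; rewrite inE => /andP[_].
by case: #|_| => [//|[|[|]]].
Qed.

Variant interior_face_spec E : Prop :=
  InteriorFaceSpec T T' of Tplus E = Some T & Tminus E = Some T' & T != T'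
    & neighbors E = [set T; T']%SET & outward E T & ~~ outward E T'.

(** Two neighbors and an injective [outward E] leave exactly one cell on each side, which determines
    both picks. *)
Lemma interior_faceP E : E \in interior_faces M -> interior_face_spec E.
Proof.
rewrite inE => /andP[Ef /cards2P[T1 [T2 [T12 EN]]]].
have T1N : T1 \in neighbors E by rewrite EN !inE eqxx.
have T2N : T2 \in neighbors E by rewrite EN !inE eqxx orbT.
have oT : outward E T2 = ~~ outward E T1.
  have : outward E T1 != outward E T2.
    by apply: contra_neq T12; exact: (neighbors_outward_inj Ef).
  by case: (outward E T1); case: (outward E T2).
wlog h1 : T1 T2 T12 EN T1N T2N oT / outward E T1.
  move=> H; have [h1|h1] := boolP (outward E T1); first exact: (H T1 T2).
  apply: (H T2 T1); rewrite 1?eq_sym ?oT ?negbK//.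
  by rewrite EN finset.setUC.
exists T1 T2; rewrite ?oT ?h1//.
- rewrite /Tplus; case: pickP => [T /andP[TN oTT]|/(_ T1)]; last first.
    by rewrite /= T1N h1.
  by congr Some; apply: (neighbors_outward_inj Ef) => //; rewrite oTT h1.
- rewrite /Tminus; case: pickP => [T /andP[TN iT]|/(_ T2)]; last first.
    by rewrite /= T2N (inward_outwardN cm Ef T2N) oT h1.
  congr Some; apply: (neighbors_outward_inj Ef) => //.
  by move: iT; rewrite (inward_outwardN cm Ef TN) oT h1 => /negPf.
Qed.

Lemma boundary_faceP E : E \in boundary_faces M ->
  exists T, [/\ Tplus E = Some T, neighbors E = [set T]%SET & outward E T].
Proof.
move=> Eb; have := Eb; rewrite inE => /andP[Ef /cards1P[T EN]].
have TN : T \in neighbors E by rewrite EN inE.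
have oT := normal_outward cm Eb TN.
exists T; split=> //; rewrite /Tplus; case: pickP => [T'|/(_ T)].
  by rewrite EN inE => /andP[/eqP ->].
by rewrite /= TN oT.
Qed.

Lemma interior_not_boundary E : E \in interior_faces M ->
  E \in boundary_faces M = false.
Proof. by rewrite !inE => /andP[-> /eqP ->]. Qed.

(** Double counting of incidences: a vertex [a] of [T] corresponds to the face of [T] opposite to
    it. *)
Lemma sum_cells_faces (F : 'I_(ncells M) -> {set 'I_(nvertices M)} -> R) :
  \sum_T \sum_(a in cell T) F T (cell T :\ a)
  = \sum_(E in faces M) \sum_(T in neighbors E) F T E.
Proof.
rewrite [RHS](exchange_big_dep predT)//=; apply: eq_bigr => T _.
transitivity (\sum_(E in [set cell T :\ a | a in cell T]%SET) F T E).
  rewrite big_imset//= => a b aT bT ab; apply/eqP/negPn/negP => nab.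
  have : a \in cell T :\ b by rewrite !inE nab.
  by rewrite -ab !inE eqxx.
apply: eq_bigl => E; apply/imsetP/andP => [[a aT ->]|[Ef TE]].
  by rewrite cell_face// inE subD1set.
by have [a aT ->] := neighbor_apex cm Ef TE; exists a.
Qed.

End MeshTopology.

(** * Traces, jumps and means of piecewise affine fields *)

Section AffineFields.
Variables (R : realType) (d : nat) (M : mesh R d).
Implicit Types (f g : 'rV[R]_d -> 'rV[R]_d) (E : {set 'I_(nvertices M)}).
Implicit Types (u v w : broken_field M).

Lemma affine_cst (c : 'rV[R]_d) : affine (fun=> c).
Proof. by exists 0, c => x; rewrite mulmx0 add0r. Qed.

Lemma affineD f g : affine f -> affine g -> affine (fun x => f x + g x).
Proof.
move=> [A [a Ef]] [B [b Eg]]; exists (A + B), (a + b) => x.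
by rewrite Ef Eg mulmxDr addrACA.
Qed.

Lemma affineZ a f : affine f -> affine (fun x => a *: f x).
Proof.
move=> [A [b Ef]]; exists (a *: A), (a *: b) => x.
by rewrite Ef scalerDr scalemxAr.
Qed.

Lemma affineB f g : affine f -> affine g -> affine (fun x => f x - g x).
Proof.
move=> af ag; under eq_fun => x do rewrite -scaleN1r.
by apply: affineD => //; exact: affineZ.
Qed.

Lemma affine_poly_fun g j : affine g -> poly_fun (fun x => g x 0 j).
Proof.
move=> [A [b Eg]]; rewrite (_ : (fun _ => _) = fun x => (b + x *m A) 0 j).
  exact: poly_fun_affine_coord.
by apply/funext => x; rewrite Eg addrC.
Qed.

Lemma poly_fun_dotv_affine f g : affine f -> affine g ->
  poly_fun (fun x => dotv (f x) (g x)).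
Proof. by move=> af ag; apply: poly_fun_dotv => j; exact: affine_poly_fun. Qed.

Lemma affine_trace o w : VDG w -> affine (trace_from o w).
Proof. by move=> Vw; case: o => [T|]; [exact: Vw|exact: affine_cst]. Qed.

Lemma affine_jump E w : VDG w -> affine (jump E w).
Proof.
move=> Vw; rewrite /jump; case: (E \in interior_faces M); last exact: affine_trace.
by apply: affineB; exact: affine_trace.
Qed.

Lemma affine_avg E w : VDG w -> affine (avg E w).
Proof.
move=> Vw; rewrite /avg; case: (E \in interior_faces M); last exact: affine_trace.
by apply: affineZ; apply: affineD; exact: affine_trace.
Qed.

Lemma trace_fromD o v w x :
  trace_from o (fun T y => v T y + w T y) x = trace_from o v x + trace_from o w x.
Proof. by case: o => [T|] //=; rewrite addr0. Qed.

Lemma jumpD E v w x :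
  jump E (fun T y => v T y + w T y) x = jump E v x + jump E w x.
Proof.
rewrite /jump; case: ifP => _; rewrite !trace_fromD//.
by rewrite opprD addrACA.
Qed.

Lemma avgD E v w x :
  avg E (fun T y => v T y + w T y) x = avg E v x + avg E w x.
Proof.
rewrite /avg; case: ifP => _; rewrite !trace_fromD//.
by rewrite addrACA scalerDr.
Qed.

Lemma VDG_D v w : VDG v -> VDG w -> VDG (fun T y => v T y + w T y).
Proof. by move=> Vv Vw T; exact: affineD. Qed.

Lemma face_intD E f g f' g' :
  affine f -> affine g -> affine f' -> affine g' ->
  face_int E (fun x => dotv (f x) (g x) + dotv (f' x) (g' x))
  = face_int E (fun x => dotv (f x) (g x))
    + face_int E (fun x => dotv (f' x) (g' x)).
Proof.
by move=> af ag af' ag'; apply: simplex_intD; exact: poly_fun_dotv_affine.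
Qed.

(** The way every zero-mean condition enters: against a constant, a field may be replaced by its
    mean. *)
Lemma face_int_P0 E (c : 'rV[R]_d) g : affine g ->
  face_int E (fun x => dotv c (g x)) = face_int E (fun=> 1) * dotv c (P0 E g).
Proof.
move=> ag; rewrite [LHS]simplex_int_sum; last first.
  by move=> j; apply: poly_funZ; exact: affine_poly_fun.
rewrite mulr_sumr; apply: eq_bigr => j _.
rewrite simplex_intZ; last exact: affine_poly_fun.
rewrite [in RHS]mxE [RHS]mulrCA; congr (c 0 j * _).
(* [P0] divides by the measure of the face. If that measure is 0, so is the Gram factor, and both
   sides vanish. *)
have [E0|E0] := eqVneq (face_int E (fun=> 1)) 0; last by rewrite mulVKf.
rewrite E0 mul0r; move: E0; rewrite /face_int simplex_int1 => /eqP.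
rewrite mulf_eq0 invr_eq0 pnatr_eq0 -[_ == 0%N]negbK -lt0n fact_gt0 orbF => /eqP E0.
by rewrite /simplex_int E0 mul0r.
Qed.

Lemma face_int_dotvDl E f f' g : affine f -> affine f' -> affine g ->
  face_int E (fun x => dotv (f x + f' x) (g x))
  = face_int E (fun x => dotv (f x) (g x))
    + face_int E (fun x => dotv (f' x) (g x)).
Proof.
move=> af af' ag; rewrite -face_intD//; apply: eq_simplex_int => x.
by rewrite dotvDl.
Qed.

Lemma face_int_dotvC E f g :
  face_int E (fun x => dotv (f x) (g x)) = face_int E (fun x => dotv (g x) (f x)).
Proof. by apply: eq_simplex_int => x; rewrite dotvC. Qed.

Lemma h_face_inv_ge0 E : 0 <= (h_face E)^-1.
Proof.
rewrite invr_ge0 /h_face /diam; set A := [set r | _].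
(* Without a supremum, [sup] takes the default value 0, which is still nonnegative. *)
have [sA|sA] := pselect (has_sup A); last by rewrite sup_out.
have [r Ar] := sA.1; apply: le_trans (ub_le_sup sA.2 Ar).
by case: Ar => x [y [_ _ ->]]; exact: sqrtr_ge0.
Qed.

End AffineFields.

(** * Symmetry and additivity of the bilinear forms *)

Section Forms.
Variables (R : realType) (d : nat) (M : mesh R d) (lam mu : R).
Implicit Types (E : {set 'I_(nvertices M)}) (T : 'I_(ncells M)).
Implicit Types (u v w : broken_field M) (A B : 'M[R]_d).

Lemma epsE (g : 'rV[R]_d -> 'rV[R]_d) A b x :
  (forall y, g y = y *m A + b) -> eps g x = 2^-1 *: (A^T + A).
Proof. by move=> Eg; rewrite /eps !(jacobian_affine x Eg). Qed.

Lemma eps_affine (g : 'rV[R]_d -> 'rV[R]_d) x y :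
  affine g -> eps g x = eps g y.
Proof. by move=> [A [b Eg]]; rewrite !(epsE _ Eg). Qed.

Lemma epsD (f g : 'rV[R]_d -> 'rV[R]_d) x : affine f -> affine g ->
  eps (fun y => f y + g y) x = eps f x + eps g x.
Proof.
move=> [A [a Ef]] [B [b Eg]]; rewrite (epsE _ Ef) (epsE _ Eg).
rewrite (@epsE _ (A + B) (a + b)).
  by rewrite -scalerDr [(A + B)^T]raddfD/= addrACA.
by move=> y; rewrite Ef Eg mulmxDr addrACA.
Qed.

Lemma stiffnessD A B :
  stiffness lam mu (A + B) = stiffness lam mu A + stiffness lam mu B.
Proof.
by rewrite /stiffness mxtraceD mulrDr scalerDr scalerDl addrACA.
Qed.

Lemma frobDl A B (C : 'M[R]_d) : frob (A + B) C = frob A C + frob B C.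
Proof.
rewrite /frob -big_split; apply: eq_bigr => i _; rewrite -big_split.
by apply: eq_bigr => j _; rewrite mxE mulrDl.
Qed.

Lemma frobZl a A B : frob (a *: A) B = a * frob A B.
Proof.
rewrite /frob mulr_sumr; apply: eq_bigr => i _; rewrite mulr_sumr.
by apply: eq_bigr => j _; rewrite mxE mulrA.
Qed.

Lemma frobC A B : frob A B = frob B A.
Proof. by apply: eq_bigr => i _; apply: eq_bigr => j _; rewrite mulrC. Qed.

Lemma frob1 A : frob 1%:M A = \tr A.
Proof.
apply: eq_bigr => i _; rewrite (bigD1 i)//= big1 ?addr0.
  by rewrite mxE eqxx mul1r.
by move=> j ji; rewrite mxE eq_sym (negPf ji) mul0r.
Qed.

Lemma frob_tr A B : frob A^T B^T = frob A B.
Proof.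
rewrite /frob exchange_big; apply: eq_bigr => i _; apply: eq_bigr => j _.
by rewrite !mxE.
Qed.

Lemma frob_stiffnessE A B :
  frob (stiffness lam mu A) B = 2 * mu * frob A B + lam * (\tr A * \tr B).
Proof. by rewrite frobDl !frobZl frob1 mulrA. Qed.

Lemma frob_stiffnessC A B :
  frob (stiffness lam mu A) B = frob (stiffness lam mu B) A.
Proof. by rewrite !frob_stiffnessE frobC [\tr A * _]mulrC. Qed.

Lemma frob_stiffness_ge0 A : 0 <= lam -> 0 <= mu ->
  0 <= frob (stiffness lam mu A) A.
Proof.
move=> lam0 mu0; rewrite frob_stiffnessE -expr2.
rewrite addr_ge0 ?[0 <= lam * _]mulr_ge0 ?sqr_ge0// mulr_ge0//.
  by rewrite mulr_ge0.
by apply: sumr_ge0 => i _; apply: sumr_ge0 => j _; rewrite -expr2 sqr_ge0.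
Qed.

Lemma stiffness_tr A : A^T = A -> (stiffness lam mu A)^T = stiffness lam mu A.
Proof. by move=> At; rewrite /stiffness raddfD/= !linearZ/= At trmx1. Qed.

Lemma eps_tr (g : 'rV[R]_d -> 'rV[R]_d) x : (eps g x)^T = eps g x.
Proof. by rewrite linearZ/= raddfD/= trmxK addrC. Qed.

(** Symmetry of the stress lets it act on the row normal from the right, the form in which
    [cell_divergence] produces it. *)
Lemma tractionE E u T x :
  traction lam mu E u T x = face_normal E *m stiffness lam mu (eps (u T) x).
Proof.
by rewrite /traction trmx_mul trmxK stiffness_tr// eps_tr.
Qed.

Lemma traction_cst E u T x y : VDG u ->
  traction lam mu E u T x = traction lam mu E u T y.
Proof. by move=> Vu; rewrite !tractionE (eps_affine x y (Vu T)). Qed.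

Lemma VDG_traction E u : VDG u -> VDG (traction lam mu E u).
Proof.
move=> Vu T; exists 0, (traction lam mu E u T 0) => x.
by rewrite mulmx0 add0r; exact: traction_cst.
Qed.

Lemma tractionD E u v : VDG u -> VDG v ->
  traction lam mu E (fun T x => u T x + v T x)
  = fun T x => traction lam mu E u T x + traction lam mu E v T x.
Proof.
move=> Vu Vv; apply/funext => T; apply/funext => x.
by rewrite !tractionE (epsD x (Vu T) (Vv T)) stiffnessD mulmxDr.
Qed.

Lemma avg_traction_cst E u x y : VDG u ->
  avg E (traction lam mu E u) x = avg E (traction lam mu E u) y.
Proof.
move=> Vu; have trc o : trace_from o (traction lam mu E u) x
    = trace_from o (traction lam mu E u) y.
  by case: o => [T|]; rewrite /trace_from; [exact: (traction_cst E T x y Vu)|].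
by rewrite /avg (trc (Tplus E)) (trc (Tminus E)).
Qed.

(** Strains of affine fields are constant on each cell, so they may be evaluated at 0 even when 0
    lies outside the cell. *)
Lemma energyE u w : VDG u -> VDG w ->
  energy lam mu u w = \sum_T cell_int T (fun=> 1)
    * frob (stiffness lam mu (eps (u T) 0)) (eps (w T) 0).
Proof.
move=> Vu Vw; apply: eq_bigr => T _; rewrite /cell_int mulrC -simplex_int_cst.
apply: eq_simplex_int => x.
by rewrite (eps_affine x 0 (Vu T)) (eps_affine x 0 (Vw T)).
Qed.

Lemma energyC u w : VDG u -> VDG w -> energy lam mu u w = energy lam mu w u.
Proof.
move=> Vu Vw; rewrite (energyE Vu Vw) (energyE Vw Vu); apply: eq_bigr => T _.
by rewrite [in RHS]frob_stiffnessC.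
Qed.

Lemma energyDl u v w : VDG u -> VDG v -> VDG w ->
  energy lam mu (fun T x => u T x + v T x) w
  = energy lam mu u w + energy lam mu v w.
Proof.
move=> Vu Vv Vw; rewrite (energyE Vu Vw) (energyE Vv Vw).
rewrite (energyE (VDG_D Vu Vv) Vw) -big_split; apply: eq_bigr => T _.
by rewrite (epsD 0 (Vu T) (Vv T)) stiffnessD frobDl mulrDr.
Qed.

Lemma energy_ge0 u : 0 <= lam -> 0 <= mu -> 0 <= energy lam mu u u.
Proof.
move=> lam0 mu0; apply: sumr_ge0 => T _; apply: simplex_int_ge0 => x.
exact: frob_stiffness_ge0.
Qed.

Definition face_consistency E u w : R :=
  face_int E (fun x => dotv (avg E (traction lam mu E u) x) (jump E w x)
                     + dotv (jump E u x) (avg E (traction lam mu E w) x)).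

Definition mean_jump_pairing E u w : R :=
  face_int E (fun x => dotv (jump E u x) (P0 E (jump E w))).

Definition jump_pairing E u w : R :=
  face_int E (fun x => dotv (jump E u x) (jump E w x)).

Lemma face_consistencyC E u w : face_consistency E u w = face_consistency E w u.
Proof.
apply: eq_simplex_int => x.
exact: etrans (addrC _ _) (congr2 +%R (dotvC _ _) (dotvC _ _)).
Qed.

(** Although [P0] is applied to the second argument alone, integration gives the face measure times
    the product of both means. *)
Lemma mean_jump_pairingC E u w : VDG u -> VDG w ->
  mean_jump_pairing E u w = mean_jump_pairing E w u.
Proof.
move=> Vu Vw; rewrite /mean_jump_pairing.
rewrite face_int_dotvC (face_int_P0 _ _ (affine_jump E Vu)) dotvC.
by rewrite -(face_int_P0 _ _ (affine_jump E Vw)) face_int_dotvC.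
Qed.

Lemma jump_pairingC E u w : jump_pairing E u w = jump_pairing E w u.
Proof. exact: face_int_dotvC. Qed.

Lemma face_consistencyDl E u v w : VDG u -> VDG v -> VDG w ->
  face_consistency E (fun T x => u T x + v T x) w
  = face_consistency E u w + face_consistency E v w.
Proof.
move=> Vu Vv Vw; rewrite /face_consistency.
have ju := affine_jump E Vu; have jv := affine_jump E Vv.
have jw := affine_jump E Vw.
have tu := affine_avg E (VDG_traction E Vu).
have tv := affine_avg E (VDG_traction E Vv).
have tw := affine_avg E (VDG_traction E Vw).
rewrite (face_intD _ tu jw ju tw) (face_intD _ tv jw jv tw) addrACA.
rewrite -(face_int_dotvDl _ tu tv jw) -(face_int_dotvDl _ ju jv tw).
rewrite -(face_intD _ (affineD tu tv) jw (affineD ju jv) tw).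
by apply: eq_simplex_int => x; rewrite (tractionD E Vu Vv) avgD jumpD.
Qed.

Lemma jumpDl_pairing E u v (g : 'rV[R]_d -> 'rV[R]_d) :
  VDG u -> VDG v -> affine g ->
  face_int E (fun x => dotv (jump E (fun T x => u T x + v T x) x) (g x))
  = face_int E (fun x => dotv (jump E u x) (g x))
    + face_int E (fun x => dotv (jump E v x) (g x)).
Proof.
move=> Vu Vv ag.
rewrite -(face_int_dotvDl _ (affine_jump E Vu) (affine_jump E Vv) ag).
by apply: eq_simplex_int => x; rewrite jumpD.
Qed.

Lemma mean_jump_pairingDl E u v w : VDG u -> VDG v ->
  mean_jump_pairing E (fun T x => u T x + v T x) w
  = mean_jump_pairing E u w + mean_jump_pairing E v w.
Proof. by move=> Vu Vv; apply: jumpDl_pairing => //; exact: affine_cst. Qed.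

Lemma jump_pairingDl E u v w : VDG u -> VDG v -> VDG w ->
  jump_pairing E (fun T x => u T x + v T x) w
  = jump_pairing E u w + jump_pairing E v w.
Proof. by move=> Vu Vv Vw; apply: jumpDl_pairing => //; exact: affine_jump. Qed.

Variables (alpha0 alpha1 : R).
Local Notation penalized := (interior_faces M :|: dirichlet_faces M).

Lemma aformIP0E u w :
  aformIP0 lam mu alpha0 u w
  = energy lam mu u w - \sum_(E in penalized) face_consistency E u w
    + alpha0 * beta0 d lam mu
      * \sum_(E in penalized) (h_face E)^-1 * mean_jump_pairing E u w.
Proof. by []. Qed.

Lemma aformIPE u w :
  aformIP lam mu alpha0 alpha1 u w
  = aformIP0 lam mu alpha0 u w
    + alpha1 * beta1 mu
      * \sum_(E in penalized) (h_face E)^-1 * jump_pairing E u w.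
Proof. by []. Qed.

Lemma aformIPC u w : VDG u -> VDG w ->
  aformIP lam mu alpha0 alpha1 u w = aformIP lam mu alpha0 alpha1 w u.
Proof.
move=> Vu Vw; rewrite !aformIPE !aformIP0E.
have aux (a b e s t r e' s' t' r' : R) : e = e' -> s = s' -> t = t' -> r = r' ->
    e - s + a * t + b * r = e' - s' + a * t' + b * r' by move=> -> -> -> ->.
apply: aux.
- exact: energyC.
- by apply: eq_bigr => E _; exact: face_consistencyC.
- by apply: eq_bigr => E _; congr (_ * _); exact: mean_jump_pairingC.
- by apply: eq_bigr => E _; congr (_ * _); exact: jump_pairingC.
Qed.

Lemma aformIPDl u v w : VDG u -> VDG v -> VDG w ->
  aformIP lam mu alpha0 alpha1 (fun T x => u T x + v T x) w
  = aformIP lam mu alpha0 alpha1 u w + aformIP lam mu alpha0 alpha1 v w.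
Proof.
move=> Vu Vv Vw; rewrite !aformIPE !aformIP0E.
have aux (a b e s t r e' s' t' r' e'' s'' t'' r'' : R) :
    e = e' + e'' -> s = s' + s'' -> t = t' + t'' -> r = r' + r'' ->
    e - s + a * t + b * r
    = (e' - s' + a * t' + b * r') + (e'' - s'' + a * t'' + b * r'').
  by move=> -> -> -> ->; ring.
apply: aux.
- exact: energyDl.
- by rewrite -big_split; apply: eq_bigr => E _; exact: face_consistencyDl.
- rewrite -big_split/=; apply: eq_bigr => E _; rewrite -mulrDr; congr (_ * _).
  exact: mean_jump_pairingDl.
- rewrite -big_split/=; apply: eq_bigr => E _; rewrite -mulrDr; congr (_ * _).
  exact: jump_pairingDl.
Qed.

End Forms.

(** * Orthogonality of [Zspace] and [VCR] for [aformIP0] *)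

Section Orthogonality.
Variables (R : realType) (m : nat) (M : mesh R m.+1) (lam mu alpha0 : R).
Hypothesis cm : conforming_mesh M.
Local Notation d := m.+1.
Implicit Types (E : {set 'I_(nvertices M)}) (T : 'I_(ncells M)).
Implicit Types (u v w z : broken_field M).

Lemma energy_face_sum z v : VDG z -> VDG v ->
  energy lam mu z v = \sum_(E in faces M) \sum_(T in neighbors E)
    face_sgn E T * face_int E (fun x => dotv (traction lam mu E v T x) (z T x)).
Proof.
move=> Vz Vv; rewrite energyC// energyE// -sum_cells_faces//.
apply: eq_bigr => T _; have [A [b Ez]] := Vz T.
set sigma := stiffness _ _ _.
(* The symmetric stress does not see the antisymmetric part of the gradient. *)
have -> : frob sigma (eps (z T) 0) = frob sigma A.
  rewrite (epsE 0 Ez) frobC frobZl frobDl -(frob_tr A^T) trmxK.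
  have -> : sigma^T = sigma by exact/stiffness_tr/eps_tr.
  by rewrite (frobC A); field.
rewrite -(cell_divergence cm T sigma Ez); apply: eq_bigr => a aT; congr (_ * _).
apply: eq_simplex_int => x; congr dotv.
by rewrite (traction_cst lam mu _ T x 0 Vv) tractionE.
Qed.

(** With [s] the traction of [v], the difference of the products [s . z] on the two sides equals
    average of [s] times jump of [z] plus jump of [s] times average of [z]. The last term integrates
    to 0, since the jump of [s] is constant and the average of [z] has zero mean. *)
Lemma interior_face_sum E z v : VDG z -> VDG v -> E \in interior_faces M ->
  P0 E (avg E z) = 0 ->
  \sum_(T in neighbors E)
    face_sgn E T * face_int E (fun x => dotv (traction lam mu E v T x) (z T x))
  = face_int E (fun x => dotv (jump E z x) (avg E (traction lam mu E v) x)).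
Proof.
move=> Vz Vv Ei z0; have [T T' ET ET' TT' EN hT hT'] := interior_faceP cm Ei.
rewrite EN big_setU1 ?inE//= big_set1 /face_sgn hT (negPf hT').
have az := affine_avg E Vz; have jz := affine_jump E Vz.
set s := traction lam mu E v.
have Vs : VDG s by exact: VDG_traction.
have zT : affine (z T) by exact: Vz.
have zT' : affine (z T') by exact: Vz.
have c0 : face_int E (fun x => dotv (s T 0 - s T' 0) (avg E z x)) = 0.
  by rewrite (face_int_P0 _ _ az) z0 dotv0r mulr0.
have jE x : jump E z x = z T x - z T' x by rewrite /jump Ei ET ET'.
have aE x : avg E z x = 2^-1 *: (z T x + z T' x) by rewrite /avg Ei ET ET'.
have sE x : avg E s x = 2^-1 *: (s T 0 + s T' 0).
  by rewrite /avg Ei ET ET' /trace_from /s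
    (traction_cst lam mu E T x 0 Vv) (traction_cst lam mu E T' x 0 Vv).
have -> : face_int E (fun x => dotv (s T x) (z T x))
    = face_int E (fun x => dotv (s T 0) (z T x)).
  by apply: eq_simplex_int => x; rewrite /s (traction_cst lam mu E T x 0 Vv).
have -> : face_int E (fun x => dotv (s T' x) (z T' x))
    = face_int E (fun x => dotv (s T' 0) (z T' x)).
  by apply: eq_simplex_int => x; rewrite /s (traction_cst lam mu E T' x 0 Vv).
rewrite -[RHS]addr0 -c0.
have -> : face_int E (fun x => dotv (jump E z x) (avg E s x))
    = face_int E (fun x => dotv (2^-1 *: (s T 0 + s T' 0)) (jump E z x)).
  by apply: eq_simplex_int => x; rewrite sE dotvC.
have ac (c : 'rV[R]_d) : affine (fun _ : 'rV[R]_d => c) by exact: affine_cst.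
rewrite -(face_intD _ (ac _) jz (ac _) az).
rewrite mul1r mulN1r -mulN1r -simplex_intZ; last exact: poly_fun_dotv_affine.
rewrite -simplex_intD; last 2 first.
- exact: poly_fun_dotv_affine.
- by apply: poly_funZ; exact: poly_fun_dotv_affine.
apply: eq_simplex_int => x; rewrite jE aE.
move: (s T 0) (s T' 0) (z T x) (z T' x) => a b p q.
by rewrite dotvZl dotvZr dotvBr dotvBl !dotvDl !dotvDr; field.
Qed.

Lemma boundary_face_sum E z v : E \in boundary_faces M ->
  \sum_(T in neighbors E)
    face_sgn E T * face_int E (fun x => dotv (traction lam mu E v T x) (z T x))
  = face_int E (fun x => dotv (jump E z x) (avg E (traction lam mu E v) x)).
Proof.
move=> Eb; have [T [ET EN hT]] := boundary_faceP cm Eb.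
rewrite EN big_set1 /face_sgn hT mul1r face_int_dotvC.
have Ei : E \in interior_faces M = false.
  by apply: contraTF Eb => /interior_not_boundary ->.
by apply: eq_simplex_int => x; rewrite /jump /avg Ei ET.
Qed.

Lemma aformIP0_orthogonal z v : Zspace z -> VCR v ->
  aformIP0 lam mu alpha0 z v = 0.
Proof.
move=> [Vz z0] [Vv v0]; rewrite /aformIP0 energy_face_sum//.
set ID := interior_faces M :|: dirichlet_faces M.
(* The faces outside [ID] are Neumann faces, where the average is the trace itself; its zero mean
   cancels against the constant traction. *)
rewrite (bigID (mem ID))/= [X in _ + X - _]big1 ?addr0; last first.
  move=> E /andP[Ef EID].
  have Ei : E \notin interior_faces M by apply: contra EID => Ei; rewrite inE Ei.
  have := face_interior_or_boundary cm Ef; rewrite (negPf Ei)/= => Eb.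
  have [T [ET EN hT]] := boundary_faceP cm Eb.
  have En : E \in neumann_faces M.
    move: Eb; rewrite -(boundary_faces_cover cm) inE => /orP[Ed|//].
    by move: EID; rewrite /ID inE Ed orbT.
  rewrite EN big_set1 /face_sgn hT mul1r.
  have := z0 E; rewrite inE En orbT /avg => /(_ isT).
  rewrite (negPf Ei) ET => Pz.
  rewrite (_ : (fun x => _) = fun x => dotv (traction lam mu E v T 0) (z T x)).
    by rewrite face_int_P0 ?Pz ?dotv0r ?mulr0//; exact: Vz.
  by apply/funext => x; rewrite (traction_cst lam mu E T x 0 Vv).
have -> : \sum_(E in ID) (h_face E)^-1
    * face_int E (fun x => dotv (jump E z x) (P0 E (jump E v))) = 0.
  rewrite big1// => E EID; rewrite face_int_dotvC.
  by rewrite (face_int_P0 _ _ (affine_jump E Vz)) (v0 E EID) dotv0l !mulr0.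
rewrite mulr0 addr0; apply/eqP; rewrite subr_eq0; apply/eqP.
apply: eq_big => [E|E /andP[Ef EID]].
  apply/andb_idl; rewrite /ID finset.in_setU => /orP[|].
    by rewrite inE => /andP[].
  by rewrite inE => /andP[]; rewrite inE => /andP[].
have az := affine_jump E Vz; have av := affine_jump E Vv.
have tz := affine_avg E (VDG_traction lam mu E Vz).
have tv := affine_avg E (VDG_traction lam mu E Vv).
rewrite (face_intD _ tz av az tv).
have -> : face_int E (fun x => dotv (avg E (traction lam mu E z) x) (jump E v x)) = 0.
  transitivity (face_int E
      (fun x => dotv (avg E (traction lam mu E z) 0) (jump E v x))).
    by apply: eq_simplex_int => x; rewrite (avg_traction_cst lam mu E x 0 Vz).
  by rewrite (face_int_P0 _ _ av) (v0 E EID) dotv0r mulr0.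
rewrite add0r; have [Ei|Ei] := boolP (E \in interior_faces M).
  by apply: interior_face_sum => //; apply: z0; rewrite inE Ei.
apply: boundary_face_sum.
by have := face_interior_or_boundary cm Ef; rewrite (negPf Ei).
Qed.

End Orthogonality.

(** * The strengthened Cauchy-Schwarz inequality *)

Section StrengthenedCauchySchwarz.
Variable R : realType.

Lemma discriminant_le0 (X Y Z : R) : 0 <= X -> 0 <= Z ->
  (forall s, 0 <= X + 2 * s * Y + s ^+ 2 * Z) -> Y ^+ 2 <= X * Z.
Proof.
move=> X0 Z0 H; have [Z0'|Zn] := eqVneq Z 0.
  have [->|Yn] := eqVneq Y 0; first by rewrite expr0n/= mulr_ge0.
  (* With [Z = 0] the expression is affine in [s], and this [s] gives it the value -1. *)
  have := H (- (X + 1) / (2 * Y)); rewrite Z0' mulr0 addr0.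
  have -> : X + 2 * (- (X + 1) / (2 * Y)) * Y = -1 by field.
  by rewrite lerNr oppr0 ler10.
have Zp : 0 < Z by rewrite lt_neqAle eq_sym Zn.
have := H (- Y / Z).
have -> : X + 2 * (- Y / Z) * Y + (- Y / Z) ^+ 2 * Z = X - Y ^+ 2 / Z by field.
by rewrite subr_ge0 ler_pdivrMr.
Qed.

(** The weighted norm of [F + s G] is a nonnegative quadratic polynomial in [s], whose coefficients
    are the three sums. *)
Lemma face_sum_Cauchy_Schwarz d (M : mesh R d)
    (P : {set {set 'I_(nvertices M)}})
    (F G : {set 'I_(nvertices M)} -> 'rV[R]_d -> 'rV[R]_d) :
  (forall E, affine (F E)) -> (forall E, affine (G E)) ->
  (\sum_(E in P) (h_face E)^-1 * face_int E (fun x => dotv (F E x) (G E x))) ^+ 2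
  <= (\sum_(E in P) (h_face E)^-1 * L2sq E (F E))
     * (\sum_(E in P) (h_face E)^-1 * L2sq E (G E)).
Proof.
move=> aF aG.
have L2_ge0 (H : {set 'I_(nvertices M)} -> 'rV[R]_d -> 'rV[R]_d) :
    0 <= \sum_(E in P) (h_face E)^-1 * L2sq E (H E).
  apply: sumr_ge0 => E _; apply: mulr_ge0; first exact: h_face_inv_ge0.
  by apply: simplex_int_ge0 => x; exact: dotv_ge0.
apply: discriminant_le0 => [||s]; [exact: L2_ge0..|].
have := L2_ge0 (fun E x => F E x + s *: G E x).
congr (_ <= _); rewrite !mulr_sumr -!big_split; apply: eq_bigr => E _ /=.
rewrite !(mulrCA _ (h_face E)^-1) -!mulrDr; congr (_ * _).
have pFF := poly_fun_dotv_affine (aF E) (aF E).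
have pFG := poly_fun_dotv_affine (aF E) (aG E).
have pGG := poly_fun_dotv_affine (aG E) (aG E).
rewrite /L2sq /face_int -(simplex_intZ _ _ (2 * s) pFG).
rewrite -(simplex_intZ _ _ (s ^+ 2) pGG).
rewrite -(simplex_intD _ _ pFF (poly_funZ (2 * s) pFG)).
rewrite -simplex_intD; last 2 first.
- by apply: poly_funD => //; exact: poly_funZ.
- exact: poly_funZ.
apply: eq_simplex_int => x; move: (F E x) (G E x) => f g.
by rewrite !dotvDl !dotvDr !dotvZl !dotvZr (dotvC g f); ring.
Qed.

Variables (m : nat) (M : mesh R m.+1) (lam mu alpha0 alpha1 rho : R).
Hypothesis cm : conforming_mesh M.
Hypotheses (lam0 : 0 <= lam) (mu0 : 0 <= mu) (alpha0_ge0 : 0 <= alpha0).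
Hypothesis alpha1_ge0 : 0 <= alpha1.
Hypothesis coercive : penalty_coercive M lam mu alpha0.
Hypothesis contraction : jump_contraction M rho.
Local Notation penalized := (interior_faces M :|: dirichlet_faces M).
Local Notation A := (aformIP lam mu alpha0 alpha1).
Implicit Types u v w z : broken_field M.

Definition jump_seminorm_sq w : R :=
  \sum_(E in penalized) (h_face E)^-1 * L2sq E (jump E w).

Lemma jump_seminorm_sq_ge0 w : 0 <= jump_seminorm_sq w.
Proof.
apply: sumr_ge0 => E _; apply: mulr_ge0; first exact: h_face_inv_ge0.
by apply: simplex_int_ge0 => x; exact: dotv_ge0.
Qed.

(** Both terms of the coercivity bound are nonnegative, hence so is [aformIP0 w w], and the [alpha1]
    penalty remains as a lower bound. *)
Lemma aformIP_ge_jump w : VDG w ->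
  alpha1 * beta1 mu * jump_seminorm_sq w <= A w w.
Proof.
move=> Vw; rewrite aformIPE lerDr; apply: le_trans (coercive Vw).
apply: addr_ge0; first by rewrite mulr_ge0 ?invr_ge0// energy_ge0.
apply: mulr_ge0.
  rewrite mulr_ge0 ?mulr_ge0 ?invr_ge0// /beta0.
  by rewrite addr_ge0 ?mulr_ge0.
apply: sumr_ge0 => E _; apply: mulr_ge0; first exact: h_face_inv_ge0.
by apply: simplex_int_ge0 => x; exact: dotv_ge0.
Qed.

Lemma penalty_weight_ge0 : 0 <= alpha1 * beta1 mu.
Proof. by rewrite !mulr_ge0. Qed.

Lemma aformIP_ge0 w : VDG w -> 0 <= A w w.
Proof.
move=> Vw; apply: le_trans (aformIP_ge_jump Vw).
exact: mulr_ge0 penalty_weight_ge0 (jump_seminorm_sq_ge0 w).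
Qed.

Lemma aformIP_strengthened_CS z v : Zspace z -> VCR v -> rho^-1 <= 1 ->
  A z v ^+ 2 <= (1 - rho^-1) * A z z * A v v.
Proof.
move=> Zz Cv rho1; have [Vz _] := Zz; have [Vv v0] := Cv.
rewrite [A z v]aformIPE aformIP0_orthogonal// add0r.
have -> : \sum_(E in penalized) (h_face E)^-1 * jump_pairing E z v
    = \sum_(E in penalized) (h_face E)^-1
        * face_int E (fun x => dotv (jump E z x - P0 E (jump E z)) (jump E v x)).
  apply: eq_bigr => E EP; congr (_ * _).
  have jz := affine_jump E Vz; have jv := affine_jump E Vv.
  have H : face_int E (fun x => dotv (- P0 E (jump E z)) (jump E v x)) = 0.
    by rewrite (face_int_P0 _ _ jv) (v0 E EP) dotv0r mulr0.
  rewrite -[LHS]addr0 -H.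
  by rewrite (face_int_dotvDl _ jz (affine_cst (- P0 E (jump E z))) jv).
set b := alpha1 * beta1 mu; have b0 : 0 <= b := penalty_weight_ge0.
rewrite exprMn.
have aF E : affine (fun x => jump E z x - P0 E (jump E z)).
  by apply: affineB; [exact: affine_jump|exact: affine_cst].
have := face_sum_Cauchy_Schwarz penalized aF (fun E => affine_jump E Vv).
set Y := \sum_(E in penalized) _; rewrite -/(jump_seminorm_sq v) => YXZ.
have sz := jump_seminorm_sq_ge0 z; have sv := jump_seminorm_sq_ge0 v.
have c0 : 0 <= 1 - rho^-1 by rewrite subr_ge0.
have YY : Y ^+ 2 <= (1 - rho^-1) * jump_seminorm_sq z * jump_seminorm_sq v.
  by apply: le_trans YXZ _; rewrite ler_wpM2r// contraction.
(* The weight [b ^+ 2] is shared out, one [b] to each jump seminorm, so that each product is bounded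
   by a diagonal value of the form; no penalty parameter is left in the constant. *)
apply: (@le_trans _ _ ((1 - rho^-1) * (b * jump_seminorm_sq z)
    * (b * jump_seminorm_sq v))).
  have -> : (1 - rho^-1) * (b * jump_seminorm_sq z) * (b * jump_seminorm_sq v)
      = b ^+ 2 * ((1 - rho^-1) * jump_seminorm_sq z * jump_seminorm_sq v).
    by move: (jump_seminorm_sq z) (jump_seminorm_sq v) (1 - rho^-1) => s t c; ring.
  by rewrite ler_wpM2l// sqr_ge0.
have Az := aformIP_ge_jump Vz; have Av := aformIP_ge_jump Vv.
by rewrite ler_pM ?mulr_ge0// ler_wpM2l.
Qed.

End StrengthenedCauchySchwarz.

(** The arithmetic-geometric mean inequality gives [|2 Y| <= g (X + Z)], so [X + 2 Y + Z] lies
    between [(1 - g) (X + Z)] and [(1 + g) (X + Z)]. Comparing squares avoids roots of [X] and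
    [Z]. *)
Lemma spectral_equivalence (R : realType) (g X Y Z : R) :
  0 <= g -> g < 1 -> 0 <= X -> 0 <= Z -> Y ^+ 2 <= g ^+ 2 * X * Z ->
  (1 + g)^-1 * (X + 2 * Y + Z) <= X + Z
  /\ X + Z <= (1 - g)^-1 * (X + 2 * Y + Z).
Proof.
move=> g0 g1 X0 Z0 YXZ.
have : `|2 * Y| <= `|g * (X + Z)|.
  rewrite -ler_sqr ?nnegrE// !real_normK ?num_real//.
  apply: (@le_trans _ _ (g ^+ 2 * (4 * (X * Z)))).
    by rewrite exprMn; nra.
  rewrite exprMn; apply: ler_wpM2l; first exact: sqr_ge0.
  by have := sqr_ge0 (X - Z); nra.
rewrite (ger0_norm (mulr_ge0 g0 (addr_ge0 X0 Z0))) ler_norml => /andP[lo up].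
split.
  by rewrite mulrC ler_pdivrMr ?ltr_wpDr//; lra.
by rewrite mulrC ler_pdivlMr ?subr_gt0//; lra.
Qed.

Theorem theorem4p3 (R : realType) (alpha0 alpha1 rho : R)
    (halpha0 : 1 <= alpha0) (halpha1 : 0 < alpha1) (hrho : 1 <= rho) :
  exists gamma : R, 0 <= gamma /\ gamma < 1 /\
    forall (d : nat) (sigma mu1 mu2 mu lam : R) (M : mesh R d),
      d = 2%N \/ d = 3%N ->
      conforming_mesh M ->
      shape_regular M sigma ->
      0 < mu1 -> mu1 < mu -> mu < mu2 -> 0 <= lam ->
      penalty_coercive M lam mu alpha0 ->
      jump_contraction M rho ->
      (forall z v : broken_field M, Zspace z -> VCR v ->
         aformIP lam mu alpha0 alpha1 z v ^+ 2
         <= gamma ^+ 2 * aformIP lam mu alpha0 alpha1 z z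
                       * aformIP lam mu alpha0 alpha1 v v) /\
      (forall z v : broken_field M, Zspace z -> VCR v ->
         (1 + gamma)^-1
           * aformIP lam mu alpha0 alpha1
               (fun T x => z T x + v T x) (fun T x => z T x + v T x)
         <= bformIP lam mu alpha0 alpha1 (z, v) (z, v) /\
         bformIP lam mu alpha0 alpha1 (z, v) (z, v)
         <= (1 - gamma)^-1
           * aformIP lam mu alpha0 alpha1
               (fun T x => z T x + v T x) (fun T x => z T x + v T x)).
Proof.
have rho0 : 0 < rho := lt_le_trans ltr01 hrho.
have rho1 : rho^-1 <= 1 by rewrite invf_le1.
have gsq : Num.sqrt (1 - rho^-1) ^+ 2 = 1 - rho^-1.
  by rewrite sqr_sqrtr ?subr_ge0.
have g0 : 0 <= Num.sqrt (1 - rho^-1) by exact: sqrtr_ge0.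
have g1 : Num.sqrt (1 - rho^-1) < 1.
  rewrite -[ltRHS]sqrtr1 ltr_sqrt ?ltr01//.
  by rewrite ltrBlDl ltrDr invr_gt0.
exists (Num.sqrt (1 - rho^-1)); do 2 split=> //.
(* Dimension 0 is excluded by the hypothesis on [d]; the geometry is developed in dimension [m.+1],
   whose faces have dimension [m]. *)
move=> [|m] sigma mu1 mu2 mu lam M; first by case.
move=> _ cm _ mu1_gt0 mu1_lt _ lam0 coercive contraction.
have mu0 : 0 <= mu := ltW (lt_trans mu1_gt0 mu1_lt).
have a0 : 0 <= alpha0 := le_trans ler01 halpha0.
have a1 : 0 <= alpha1 := ltW halpha1.
have CS (z v : broken_field M) : Zspace z -> VCR v ->
    aformIP lam mu alpha0 alpha1 z v ^+ 2
    <= Num.sqrt (1 - rho^-1) ^+ 2 * aformIP lam mu alpha0 alpha1 z z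
       * aformIP lam mu alpha0 alpha1 v v.
  by move=> Zz Cv; rewrite gsq; exact: aformIP_strengthened_CS.
split=> // z v Zz Cv; have [Vz _] := Zz; have [Vv _] := Cv.
have Vzv := VDG_D Vz Vv.
(* Additivity is available in the first argument, and symmetry carries it over to the second. *)
rewrite (aformIPDl _ _ _ _ Vz Vv Vzv) (aformIPC _ _ _ _ Vz Vzv).
rewrite (aformIPC _ _ _ _ Vv Vzv) !(aformIPDl _ _ _ _ Vz Vv)//.
rewrite (aformIPC _ _ _ _ Vv Vz) /bformIP/=.
set X := aformIP _ _ _ _ z z; set Y := aformIP _ _ _ _ z v.
set Z := aformIP _ _ _ _ v v.
have -> : X + Y + (Y + Z) = X + 2 * Y + Z by ring.
apply: spectral_equivalence => //; last exact: CS.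
- exact: (aformIP_ge0 lam0 mu0 a0 a1 coercive Vz).
- exact: (aformIP_ge0 lam0 mu0 a0 a1 coercive Vv).
Qed.
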